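(* Let $\Gamma$ be a finite tree having an essential vertex, with a fixed univalent root vertex $u_0$. Then the configuration space $F(\Gamma,2)$, equipped with the involution $\tau(x,y)=(y,x)$, is $\mathbf{Z}_2$-equivariantly homotopy equivalent to the 1-dimensional cell complex $Q_\Gamma$ equipped with its involution $T$.
   Context: $F(\Gamma,2)=\{(x,y)\in\Gamma\times\Gamma : x\ne y\}$ is the configuration space of two distinct points on $\Gamma$, with the subspace topology. The degree $\eta(v)$ of a vertex $v$ of $\Gamma$ is the number of edges incident to $v$; $v$ is essential if $\eta(v)\ge 3$ and univalent if $\eta(v)=1$. With the univalent root vertex $u_0$ fixed, each vertex $v\ne u_0$ has a unique descending edge incident to it, namely the edge through which the minimal path from $v$ to $u_0$ passes; the other $\eta(v)-1$ edges incident to $v$ are called ascending. $Q_\Gamma$ is the 1-dimensional cell complex with two 0-cells $A$ and $B$, and with 1-cells connecting $A$ to $B$, exactly one for each triple $(v,e,e')$ where $v$ is an essential vertex of $\Gamma$ and $(e,e')$ is an ordered pair of distinct ascending edges incident to $v$. Thus there are $\sum_v(\eta(v)-1)(\eta(v)-2)$ one-cells, the sum being over essential vertices $v$. The free involution $T:Q_\Gamma\to Q_\Gamma$ interchanges $A$ and $B$ and maps the 1-cell labelled $(v,e,e')$ homeomorphically onto the 1-cell labelled $(v,e',e)$. (Equivalently, $Q_\Gamma$ is the unreduced suspension, with suspension coordinate $t\in[0,1]$, of the discrete set of labels $(v,e,e')$, and $T$ sends $[(v,e,e'),t]$ to $[(v,e',e),1-t]$.) *)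

(* Defs.v *)
From HB Require Import structures.
From mathcomp Require Import all_boot all_order all_algebra.
From mathcomp Require Import generic_quotient.
From mathcomp Require Import all_classical all_reals all_analysis.

Set Implicit Arguments.
Unset Strict Implicit.
Unset Printing Implicit Defensive.

Import Order.TTheory GRing.Theory Num.Theory.
Import numFieldNormedType.Exports.

Local Open Scope classical_set_scope.
Local Open Scope ring_scope.
Local Open Scope quotient_scope.

Section UnitInterval.
Variable R : realType.

Definition unitI : set R := `[0, 1].

Definition unitI_of (t : R) (ht : 0 <= t <= 1) : unitI :=
  exist _ t (mem_set (ht : unitI t)).

Lemma unitI_bound (t : unitI) : 0 <= set_val t <= 1.
Proof. by have := set_valP t; rewrite /unitI /= in_itv. Qed.

Lemma unitI0_subproof : 0 <= (0 : R) <= 1.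
Proof. by rewrite lexx ler01. Qed.

Lemma unitI1_subproof : 0 <= (1 : R) <= 1.
Proof. by rewrite lexx ler01. Qed.

Lemma unitI_rev_subproof (t : unitI) : 0 <= 1 - set_val t <= 1.
Proof.
by have /andP[t0 t1] := unitI_bound t; rewrite subr_ge0 t1 lerBlDr lerDl t0.
Qed.

Definition unitI0 : unitI := unitI_of unitI0_subproof.
Definition unitI1 : unitI := unitI_of unitI1_subproof.
Definition unitI_rev (t : unitI) : unitI := unitI_of (unitI_rev_subproof t).

Lemma unitI_inj (s t : unitI) : set_val s = set_val t -> s = t.
Proof. by rewrite !set_valE => /val_inj. Qed.

Lemma unitI_revK : involutive unitI_rev.
Proof. by move=> t; apply: unitI_inj; rewrite !set_valE /= subKr. Qed.

Lemma unitI_rev0 : unitI_rev unitI0 = unitI1.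
Proof. by apply: unitI_inj; rewrite !set_valE /= subr0. Qed.

Lemma unitI_rev1 : unitI_rev unitI1 = unitI0.
Proof. by apply: unitI_inj; rewrite !set_valE /= subrr. Qed.

Lemma unitI0_neq1 : unitI0 != unitI1.
Proof.
apply/eqP => /(congr1 set_val); rewrite !set_valE /= => /eqP.
by rewrite eq_sym oner_eq0.
Qed.

Lemma unitI_rev_continuous : continuous unitI_rev.
Proof.
apply: continuous_comp_initial => t.
have vt : set_val s @[s --> t] --> (set_val t : R).
  exact: (@initial_continuous unitI _ set_val t).
rewrite (_ : set_val \o unitI_rev = fun s => 1 - set_val s).
  have Ft : Filter (nbhs t) by exact: nbhs_filter.
  exact: (@cvgB _ _ _ (nbhs t) Ft _ _ _ _ (@cvg_cst R (1:R) _ _ Ft) vt).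
by apply/funext => s; rewrite /= !set_valE.
Qed.

End UnitInterval.

Arguments unitI R : clear implicits.
Arguments unitI0 {R}.
Arguments unitI1 {R}.

Section EquivariantHomotopy.
Variables (R : realType) (X Y : topologicalType).
Variables (sX : X -> X) (sY : Y -> Y).

Definition equivariant (f : X -> Y) := forall x, f (sX x) = sY (f x).

Definition equivariantly_homotopic (f g : X -> Y) :=
  exists H : X * unitI R -> Y,
    [/\ continuous H,
        forall x, H (x, unitI0) = f x,
        forall x, H (x, unitI1) = g x &
        forall t, equivariant (fun x => H (x, t))].

End EquivariantHomotopy.

Definition Z2_homotopy_equivalent (R : realType) (X Y : topologicalType)
    (sX : X -> X) (sY : Y -> Y) :=
  exists (f : X -> Y) (g : Y -> X),
    [/\ continuous f /\ equivariant sX sY f,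
        continuous g /\ equivariant sY sX g,
        equivariantly_homotopic R sX sX (g \o f) id &
        equivariantly_homotopic R sY sY (f \o g) id].

Arguments Z2_homotopy_equivalent R X Y sX sY : clear implicits.

(* Finite simple graphs are given by their adjacency relation; an edge is the
   unordered pair of its end points.  Every finite tree is a simple graph. *)
Section Trees.
Variables (V : finType) (e : rel V).

(* A [ucycle] with fewer than three vertices is empty or runs back and forth
   along one edge, so it is not a cycle of the graph. *)
Definition is_tree :=
  [/\ symmetric e, irreflexive e,
      forall v w, connect e v w &
      forall c : seq V, ucycle e c -> (size c < 3)%N].

Definition is_edge (E : {set V}) : bool :=
  [exists v, exists w, e v w && (E == [set v; w]%SET)].

Definition incident_edges (v : V) : {set {set V}} :=
  [set E : {set V} | is_edge E & v \in E]%SET.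

Definition degree (v : V) : nat := #|incident_edges v|.

Definition essential (v : V) := (3 <= degree v)%N.

Definition univalent (v : V) := degree v == 1%N.

(* The path visits v followed by the vertices of p. *)
Definition minimal_path (v w : V) (p : seq V) :=
  [/\ path e v p, last v p = w &
      forall q, path e v q -> last v q = w -> (size p <= size q)%N].

Definition descending (u0 v : V) (E : {set V}) :=
  exists w p, minimal_path v u0 (w :: p) /\ E = [set v; w]%SET.

Definition ascending (u0 v : V) (E : {set V}) :=
  E \in incident_edges v /\ ~ descending u0 v E.

End Trees.

Section ConfigurationSpace.
Variables (R : realType) (V : finType) (e : rel V).

(* Geometric realization in barycentric coordinates: formal convex combinations
   of vertices whose support lies in a vertex or in an edge. *)
Definition realization : set (prod_topology (fun _ : V => R)) :=
  [set x | [/\ forall v, 0 <= x v,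
               \sum_v x v = 1 &
               exists v w, (v == w) || e v w /\
                 forall u, u != v -> u != w -> x u = 0]].

Definition conf2 : set (realization * realization) :=
  [set p : realization * realization | p.1 <> p.2].

Lemma conf2_swap_subproof (p : conf2) :
  conf2 ((set_val p).2, (set_val p).1).
Proof. by have /= p12 := set_valP p; apply/nesym. Qed.

Definition conf2_swap (p : conf2) : conf2 :=
  exist _ ((set_val p).2, (set_val p).1) (mem_set (@conf2_swap_subproof p)).

Lemma conf2_swapK : involutive conf2_swap.
Proof. by case=> -[x y] xy; exact: eq_sig_hprop. Qed.

Lemma conf2_swap_continuous : continuous conf2_swap.
Proof.
apply: continuous_comp_initial => p.
have cp := @initial_continuous (conf2 : Type) _ set_val p.
rewrite (_ : set_val \o conf2_swap = (fun q => (q.2, q.1)) \o set_val).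
  exact: (@continuous_comp (conf2 : Type) _ _ _ _ p cp (@swap_continuous _ _ (set_val p))).
by apply/funext => q; rewrite /= !set_valE.
Qed.

End ConfigurationSpace.

Arguments realization R {V} e.
Arguments conf2 R {V} e.
Arguments conf2_swap R {V} e.

Section QGamma.
Variables (R : realType) (V : finType) (e : rel V) (u0 : V).

Definition label : set (V * {set V} * {set V}) :=
  [set l | [/\ essential e l.1.1, ascending e u0 l.1.1 l.1.2,
               ascending e u0 l.1.1 l.2 & l.1.2 <> l.2]].

Lemma label_swap_subproof (l : label) :
  label ((set_val l).1.1, (set_val l).2, (set_val l).1.2).
Proof. by have [? ? ? ?] := set_valP l; split=> //; exact/nesym. Qed.

Definition label_swap (l : label) : label :=
  exist _ ((set_val l).1.1, (set_val l).2, (set_val l).1.2)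
    (mem_set (@label_swap_subproof l)).

Lemma label_swapK : involutive label_swap.
Proof. by case=> -[[v E] E'] h; exact: eq_sig_hprop. Qed.

Lemma label_swap_free l : label_swap l != l.
Proof.
apply/eqP => /(congr1 set_val) lE; have [_ _ _] := set_valP l; apply.
by have := congr1 snd lE; rewrite !set_valE.
Qed.

(* The complex is obtained from the disjoint union of its 0-skeleton {A, B}
   (index None, A = false, B = true) and of one copy of [0, 1] per label by
   gluing the initial point of every 1-cell to A and its end point to B. *)
Definition precell (o : option label) : topologicalType :=
  if o is Some _ then unitI R else bool.

Definition pre_Q := {o : option label & precell o}.

Definition vertexA : pre_Q := existT precell None false.
Definition vertexB : pre_Q := existT precell None true.
Definition point1 (l : label) (t : unitI R) : pre_Q := existT precell (Some l) t.

Definition attach (p : pre_Q) : pre_Q :=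
  match p with
  | existT (Some _) t =>
      if t == unitI0 then vertexA else if t == unitI1 then vertexB else p
  | _ => p
  end.

Definition glue (p q : pre_Q) := attach p == attach q.

Lemma glue_refl : reflexive glue.
Proof. by move=> p; exact: eqxx. Qed.

Lemma glue_sym : symmetric glue.
Proof. by move=> p q; exact: eq_sym. Qed.

Lemma glue_trans : transitive glue.
Proof. by move=> q p r /eqP pq /eqP qr; rewrite /glue pq qr. Qed.

Definition glue_equiv := EquivRel glue glue_refl glue_sym glue_trans.

Definition QGamma := {eq_quot glue_equiv}.

HB.instance Definition _ := Topological.copy QGamma (quotient_topology QGamma).
HB.instance Definition _ := Quotient.on QGamma.

Definition pre_T (p : pre_Q) : pre_Q :=
  match p with
  | existT (Some l) t => point1 (label_swap l) (unitI_rev t)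
  | existT None b => existT precell None (~~ b)
  end.

Definition QGamma_T (x : QGamma) : QGamma := \pi_QGamma (pre_T (repr x)).

Lemma pi_QGammaP (p q : pre_Q) :
  \pi_QGamma p = \pi_QGamma q <-> attach p = attach q.
Proof.
split=> [/(@eqmodP _ glue_equiv)|pq]; first by move/eqP.
by apply/(@eqmodP _ glue_equiv)/eqP.
Qed.

Lemma pre_TK : involutive pre_T.
Proof.
case=> -[l t|b] /=; last by rewrite negbK.
by rewrite /point1 label_swapK unitI_revK.
Qed.

Lemma attach_pre_T (p : pre_Q) : attach (pre_T p) = pre_T (attach p).
Proof.
case: p => -[l t|b] //=.
have r0 : (unitI_rev t == unitI0) = (t == unitI1).
  by rewrite -unitI_rev1 (inj_eq (can_inj (@unitI_revK R))).
have r1 : (unitI_rev t == unitI1) = (t == unitI0).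
  by rewrite -unitI_rev0 (inj_eq (can_inj (@unitI_revK R))).
rewrite r0 r1; case: (eqVneq t unitI0) => [->|_].
  by rewrite (negbTE (unitI0_neq1 R)).
by case: ifP.
Qed.

Lemma QGamma_T_pi (p : pre_Q) : QGamma_T (\pi_QGamma p) = \pi_QGamma (pre_T p).
Proof.
apply/pi_QGammaP; rewrite !attach_pre_T; congr pre_T.
by apply/pi_QGammaP; rewrite reprK.
Qed.

Lemma QGamma_TK : involutive QGamma_T.
Proof. by elim/quotW => p; rewrite !QGamma_T_pi pre_TK reprK. Qed.

Lemma QGamma_T_free (x : QGamma) : QGamma_T x <> x.
Proof.
elim/quotW: x => p; rewrite QGamma_T_pi => /pi_QGammaP; rewrite attach_pre_T.
case: (attach p) => -[l t|b].
  move=> /(congr1 (@projT1 _ _)) [] /eqP.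
  by rewrite (negbTE (label_swap_free l)).
by move=> /(congr1 (fun q : pre_Q => if q is existT None c then c else b)); case: b.
Qed.

Lemma pre_T_continuous : continuous pre_T.
Proof.
pose F (o : option label) : precell o -> pre_Q :=
  fun y => pre_T (existT precell o y).
have -> : pre_T = (fun p => F _ (projT2 p)) by apply/funext => -[].
apply: (@sigT_continuous _ _ _ F) => -[l|] /= t.
  apply: (@continuous_comp _ _ _ (@unitI_rev R) (point1 (label_swap l))).
    exact: unitI_rev_continuous.
  exact: existT_continuous.
have cN : continuous negb.
  by apply/continuousP => U _; exact: discrete_open.
apply: (@continuous_comp bool bool _ negb (existT precell None)); first exact: cN.
exact: existT_continuous.
Qed.

Lemma QGamma_T_continuous : continuous QGamma_T.
Proof.
apply/(@quotient_continuous _ QGamma).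
rewrite (_ : _ \o _ = \pi_QGamma \o pre_T).
  move=> p; apply: continuous_comp; first exact: pre_T_continuous.
  exact: (@pi_continuous _ QGamma).
by apply/funext => p; rewrite /= QGamma_T_pi.
Qed.

End QGamma.

Arguments QGamma R {V} e u0.
Arguments QGamma_T R {V} e u0.

(* Main.v *)
Require Import Defs.
From HB Require Import structures.
From mathcomp Require Import all_boot all_order all_algebra.
From mathcomp Require Import all_classical all_reals all_analysis.
From mathcomp Require Import lra ring.

Import Order.TTheory GRing.Theory Num.Theory.
Import numFieldNormedType.Exports.

Set Implicit Arguments.
Unset Strict Implicit.
Unset Printing Implicit Defensive.

Local Open Scope classical_set_scope.
Local Open Scope ring_scope.

(** Root the tree at u0. The arc from u0 to a point x of the tree covers, for
    every vertex w other than u0, some proportion h_w(x) in [0, 1] of the edge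
    that descends from w, and these proportions determine x. In barycentric
    coordinates h_w(x) is the sum of the x_v over the v such that w lies on the
    arc to v ([upsum]), with linear inverse [bary]; the possible h are the arcs
    of length r towards a vertex c ([prof c r]). In these coordinates the geometry
    of the tree is given by formulas that are visibly continuous: the height of x
    is the sum of the h_w (the root contributes the constant 1), and the last
    common point x /\ y of the arcs to x and y is the coordinatewise minimum.

    For distinct points x, y let a and b be their distances to x /\ y; then
    a + b is their distance, so t = a / (a + b) is a continuous function on the
    configuration space ([ratio]). It is 0 when x lies on the arc to y, 1 when
    y lies on the arc to x, and if 0 < t < 1 then x /\ y is an essential vertex
    v where the two arcs leave through distinct ascending edges E, E'. The map
    to the complex sends (x, y) to the point with parameter t of the cell
    (v, E, E'). It is continuous because t is, because the label is locally
    constant where 0 < t < 1, and because all cells share their end points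
    ([continuous_cell_point]). Exchanging x and y replaces t by 1 - t and swaps
    E and E', which is the involution T.

    In the other direction let v have height k, and let c, c' be the upper ends
    of E, E'. The cell (v, E, E') is sent to the pairs of points on the arcs to
    c and c' whose heights run along straight lines from (0, 1) through
    (k + 1, k + 1) to (1, 0) ([target]). Such points collide only at equal
    heights at most k, which does not happen. The ends go to (u0, u1) and
    (u1, u0), where u1 is the only neighbour of the univalent root, so the maps
    on the cells fit together.

    The composite on the configuration space is deformed to the identity by
    moving the heights of x and y along straight lines ([moved]). The difference
    of the heights stays a positive multiple of b - a, so the points can only
    meet when a = b; then both lie, and stay, strictly above x /\ y
    ([moved_neq]). A point that has to go up does so inside the edge where it
    lies ([target_above]), and this makes the motion continuous. The composite
    on the complex maps every cell to itself fixing its ends, so moving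
    parameters along segments deforms it to the identity. All constructions are
    symmetric in x and y, hence equivariant. *)

(** * Continuity criteria *)

Section RealValued.
Variables (R : realType) (Z : topologicalType).
Implicit Types f g : Z -> R.

Lemma continuous_add f g : continuous f -> continuous g -> continuous (fun z => f z + g z).
Proof. by move=> cf cg z; apply: cvgD; [apply: cf|apply: cg]. Qed.

Lemma continuous_opp f : continuous f -> continuous (fun z => - f z).
Proof. by move=> cf z; apply: cvgN; apply: cf. Qed.

Lemma continuous_sub f g : continuous f -> continuous g -> continuous (fun z => f z - g z).
Proof. by move=> cf cg; apply: continuous_add => //; apply: continuous_opp. Qed.

Lemma continuous_mul f g : continuous f -> continuous g -> continuous (fun z => f z * g z).
Proof. by move=> cf cg z; apply: cvgM; [apply: cf|apply: cg]. Qed.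

Lemma continuous_inv f : (forall z, f z != 0) -> continuous f -> continuous (fun z => (f z)^-1).
Proof. by move=> f0 cf z; apply: cvgV; [apply: f0|apply: cf]. Qed.

Lemma continuous_minr f g : continuous f -> continuous g ->
  continuous (fun z => Num.min (f z) (g z)).
Proof. by move=> cf cg z; apply: continuous_min; [apply: cf|apply: cg]. Qed.

Lemma continuous_maxr f g : continuous f -> continuous g ->
  continuous (fun z => Num.max (f z) (g z)).
Proof. by move=> cf cg z; apply: continuous_max; [apply: cf|apply: cg]. Qed.

Lemma continuous_sumr (I : finType) (P : pred I) (F : I -> Z -> R) :
  (forall i, continuous (F i)) -> continuous (fun z => \sum_(i | P i) F i z).
Proof.
move=> cF; rewrite (_ : (fun z => _) = (fun z => \sum_(i <- index_enum I | P i) F i z)) //.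
elim: (index_enum I) => [|i s IH].
  by under eq_fun do rewrite big_nil; apply: cst_continuous.
under eq_fun do rewrite big_cons; case: (P i) => //.
by apply: continuous_add.
Qed.

Lemma near_gt0 f z : continuous f -> 0 < f z -> \forall z' \near z, 0 < f z'.
Proof.
move=> cf fz; apply: (cf z [set y | 0 < y]); apply: open_nbhs_nbhs; split => //.
Qed.

Lemma continuous_unitI (F : Z -> unitI R) :
  continuous (fun z => set_val (F z) : R) -> continuous F.
Proof. by move=> cF; apply: continuous_comp_initial. Qed.

End RealValued.

Lemma continuous_fst (X Y Z : topologicalType) (f : X -> Z) :
  continuous f -> continuous (fun z : X * Y => f z.1).
Proof.
move=> cf z; apply: (@continuous_comp _ _ _ fst f); last exact: cf.
exact: cvg_fst.
Qed.

Lemma continuous_snd (X Y Z : topologicalType) (f : Y -> Z) :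
  continuous f -> continuous (fun z : X * Y => f z.2).
Proof.
move=> cf z; apply: (@continuous_comp _ _ _ snd f); last exact: cf.
exact: cvg_snd.
Qed.

Section UnitInterval.
Variable R : realType.

Lemma unitI_ofE (t : R) (ht : 0 <= t <= 1) : set_val (unitI_of ht) = t.
Proof. by rewrite set_valE. Qed.

Lemma unitI0E : set_val (unitI0 : unitI R) = 0.
Proof. exact: unitI_ofE. Qed.

Lemma unitI1E : set_val (unitI1 : unitI R) = 1.
Proof. exact: unitI_ofE. Qed.

Lemma unitI_revE (t : unitI R) : set_val (unitI_rev t) = 1 - set_val t.
Proof. exact: unitI_ofE. Qed.

End UnitInterval.

Lemma unitI_val_continuous (R : realType) : continuous (fun t : unitI R => set_val t : R).
Proof. exact: (@initial_continuous (unitI R) _ set_val). Qed.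

Section Configurations.
Variables (R : realType) (V : finType) (e : rel V).

Lemma continuous_realization (Z : topologicalType) (F : Z -> realization R e) :
  (forall v, continuous (fun z => set_val (F z) v : R)) -> continuous F.
Proof.
move=> cF; apply: continuous_comp_initial => z; apply/cvg_sup => v.
exact: (@continuous_comp_initial _ _ _ _ (fun z => set_val (F z)) (cF v)).
Qed.

Lemma realization_coord_continuous (v : V) :
  continuous (fun x : realization R e => set_val x v : R).
Proof.
move=> x; apply: (@continuous_comp (realization R e) _ _ set_val
  (fun y : prod_topology (fun _ : V => R) => y v)).
  exact: (@initial_continuous (realization R e) _ set_val).
exact: (@proj_continuous V (fun _ => R) v).
Qed.

Lemma continuous_conf2 (Z : topologicalType) (F : Z -> conf2 R e) :
  continuous (fun z => (set_val (F z)).1) -> continuous (fun z => (set_val (F z)).2) ->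
  continuous F.
Proof.
move=> c1 c2; apply: continuous_comp_initial => z.
rewrite (_ : _ \o _ = fun z => ((set_val (F z)).1, (set_val (F z)).2)).
  exact: (cvg_pair (c1 z) (c2 z)).
by apply/funext => y /=; rewrite -surjective_pairing.
Qed.

Lemma conf2_coord_continuous (v : V) :
  continuous (fun p : conf2 R e => set_val (set_val p).1 v : R).
Proof.
move=> p; apply: (@continuous_comp (conf2 R e) _ _ set_val
  (fun q : realization R e * realization R e => set_val q.1 v : R)).
  exact: (@initial_continuous (conf2 R e) _ set_val).
apply: (@continuous_comp _ _ _ fst (fun x : realization R e => set_val x v : R)).
  exact: cvg_fst.
exact: realization_coord_continuous.
Qed.

End Configurations.

Section CellComplex.
Variables (R : realType) (V : finType) (e : rel V) (u0 : V).
Local Notation Q := (QGamma R e u0).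
Local Notation label := (label e u0).

Definition cell_point (l : label) (t : unitI R) : Q := (\pi_Q (point1 l t))%qT.

Lemma cell_point0 l l2 : cell_point l unitI0 = cell_point l2 unitI0.
Proof. by apply/pi_QGammaP; rewrite /= eqxx. Qed.

Lemma cell_point1 l l2 : cell_point l unitI1 = cell_point l2 unitI1.
Proof. by apply/pi_QGammaP; rewrite /= eqxx eq_sym (negbTE (unitI0_neq1 R)). Qed.

Lemma cell_point_end l l2 (t : unitI R) : ~~ (0 < (set_val t : R) < 1) ->
  cell_point l t = cell_point l2 t.
Proof.
have /andP[t0 t1] := unitI_bound t; rewrite negb_and -!leNgt => /orP[h|h].
  have -> : t = unitI0 by apply: unitI_inj; rewrite unitI0E; apply/eqP; rewrite eq_le h.
  exact: cell_point0.
have -> : t = unitI1 by apply: unitI_inj; rewrite unitI1E; apply/eqP; rewrite eq_le t1.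
exact: cell_point1.
Qed.

Lemma cell_point_continuous l : continuous (cell_point l).
Proof.
move=> t; apply: (@continuous_comp _ _ _ (point1 l) (fun p => (\pi_Q p)%qT)).
  exact: existT_continuous.
exact: (@pi_continuous _ Q).
Qed.

Lemma cell_point_T l t :
  QGamma_T R e u0 (cell_point l t) = cell_point (label_swap l) (unitI_rev t).
Proof. by rewrite /cell_point QGamma_T_pi. Qed.

(** Near a parameter 0 or 1 the label may jump, but for each of the finitely many
    labels the map with that label held fixed is continuous and takes the same
    value, the common end of all cells. This one criterion gives the continuity
    both of the map to the complex and of the homotopy on the complex, and
    spares a comparison of the quotient topology with products. *)
Lemma continuous_cell_point (Z : topologicalType) (lam : Z -> label) (tau : Z -> unitI R) :
  continuous tau ->
  (forall z, 0 < (set_val (tau z) : R) < 1 -> \forall z' \near z, lam z' = lam z) ->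
  continuous (fun z => cell_point (lam z) (tau z)).
Proof.
move=> ctau clam z U nU; have Fz : Filter (nbhs z) by exact: nbhs_filter.
have cl l : (fun z => cell_point l (tau z)) @ z --> cell_point l (tau z).
  apply: (@continuous_comp _ _ _ tau (cell_point l)); first exact: ctau.
  exact: cell_point_continuous.
have [mid|ends] := boolP (0 < (set_val (tau z) : R) < 1).
  have := @filterI _ _ Fz _ _ (clam z mid) (cl _ _ nU).
  by apply: filterS => z' [/= ->].
have all_l l : cell_point l (tau z) = cell_point (lam z) (tau z).
  exact: cell_point_end.
have nall : \forall z' \near z, forall l : V * {set V} * {set V},
   forall hl : label l, U (cell_point (exist _ l (mem_set hl)) (tau z')).
  apply: filter_forall => l.
  have [hl|nhl] := pselect (label l); last first.
    by apply: (@filterS _ _ Fz _ _ _ (@filterT _ _ Fz)) => z' _ hl; case: nhl.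
  have nU' : nbhs (cell_point (exist _ l (mem_set hl)) (tau z)) U by rewrite all_l.
  apply: (@filterS _ _ Fz _ _ _ (cl _ _ nU')) => z' /= Uz' hl'.
  by rewrite (Prop_irrelevance hl' hl).
apply: (@filterS _ _ Fz _ _ _ nall) => z' H /=; have := H (set_val (lam z')) (set_valP (lam z')).
by congr (U (cell_point _ _)); exact: eq_sig_hprop.
Qed.

Definition pre_tau (p : pre_Q R e u0) : unitI R :=
  match p with
  | existT (Some _) t => t
  | existT None b => if b then unitI1 else unitI0
  end.

(** A function supported on the interior of the cell l: it shows that this
    interior is open. *)
Definition pre_bump (l : label) (p : pre_Q R e u0) : R :=
  match p with
  | existT (Some l') t => if l' == l then set_val t * (1 - set_val t) else 0
  | existT None _ => 0
  end.

Lemma pre_tau_attach p : pre_tau (attach p) = pre_tau p.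
Proof. by case: p => -[l t|b] //=; case: eqVneq => [->|_] //; case: eqVneq => [->|]. Qed.

Lemma pre_bump_attach l p : pre_bump l (attach p) = pre_bump l p.
Proof.
case: p => -[l' t|b] //=; case: eqVneq => [->|_] /=.
  by case: ifP => // _; rewrite !set_valE /= mul0r.
case: eqVneq => [->|_] //=.
by case: ifP => // _; rewrite !set_valE /= subrr mulr0.
Qed.

Definition tauQ (q : Q) : unitI R := pre_tau (repr q).
Definition bumpQ (l : label) (q : Q) : R := pre_bump l (repr q).
(** The two 0-cells belong to no particular cell; l0 is their default label. *)
Definition labelQ (l0 : label) (q : Q) : label :=
  if repr q is existT (Some l) _ then l else l0.

Lemma tauQ_pi p : tauQ (\pi_Q p)%qT = pre_tau p.
Proof.
rewrite /tauQ -pre_tau_attach -[RHS]pre_tau_attach; congr pre_tau.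
by apply/pi_QGammaP; rewrite reprK.
Qed.

Lemma bumpQ_pi l p : bumpQ l (\pi_Q p)%qT = pre_bump l p.
Proof.
rewrite /bumpQ -pre_bump_attach -[RHS]pre_bump_attach; congr pre_bump.
by apply/pi_QGammaP; rewrite reprK.
Qed.

Lemma tauQ_cell_point l t : tauQ (cell_point l t) = t.
Proof. exact: tauQ_pi. Qed.

(** Every point of the complex is the point of some cell, also the two 0-cells,
    since there is at least one label. *)
Lemma cell_pointE l0 q : q = cell_point (labelQ l0 q) (tauQ q).
Proof.
rewrite /labelQ /tauQ -{1}[q]reprK; case: (repr q) => -[l t|b] //=.
case: b; last by apply/pi_QGammaP; rewrite /= eqxx.
by apply/pi_QGammaP; rewrite /= eqxx eq_sym (negbTE (unitI0_neq1 R)).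
Qed.

Lemma bumpQ_gt0 l0 l q : 0 < bumpQ l q -> labelQ l0 q = l.
Proof.
rewrite /bumpQ /labelQ; case: (repr q) => -[l' t|b] /=; last by rewrite ltxx.
by case: eqVneq => //; rewrite ltxx.
Qed.

Lemma bumpQ_labelQ l0 q : 0 < (set_val (tauQ q) : R) < 1 -> 0 < bumpQ (labelQ l0 q) q.
Proof.
rewrite /bumpQ /labelQ /tauQ; case: (repr q) => -[l t|b] /=.
  by rewrite eqxx => /andP[t0 t1]; rewrite mulr_gt0// subr_gt0.
by case: b; rewrite !set_valE /= ltxx ?andbF.
Qed.

Lemma labelQ_cell_point l0 l t : 0 < (set_val t : R) < 1 -> labelQ l0 (cell_point l t) = l.
Proof.
move=> /andP[t0 t1]; apply: bumpQ_gt0; rewrite bumpQ_pi /= eqxx.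
by rewrite mulr_gt0// subr_gt0.
Qed.

Lemma tauQ_continuous : continuous tauQ.
Proof.
apply/(@quotient_continuous _ Q).
have -> : tauQ \o \pi_Q%qT = pre_tau by apply/funext => p; rewrite /= tauQ_pi.
pose F (o : option label) : precell R o -> unitI R := fun y => pre_tau (existT _ o y).
have -> : pre_tau = (fun p => F _ (projT2 p)) by apply/funext => -[].
apply: (@sigT_continuous _ _ _ F) => -[l|] t; first exact: cvg_id.
by apply/continuousP: t => U _; apply: discrete_open.
Qed.

Lemma bumpQ_continuous l : continuous (bumpQ l).
Proof.
apply/(@quotient_continuous _ Q).
have -> : bumpQ l \o \pi_Q%qT = pre_bump l by apply/funext => p; rewrite /= bumpQ_pi.
pose F (o : option label) : precell R o -> R := fun y => pre_bump l (existT _ o y).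
have -> : pre_bump l = (fun p => F _ (projT2 p)) by apply/funext => -[].
apply: (@sigT_continuous _ _ _ F) => -[l'|]; last exact: cst_continuous.
rewrite /F /=; case: (l' == l); last exact: cst_continuous.
apply: continuous_mul; first exact: unitI_val_continuous.
by apply: continuous_sub; [apply: cst_continuous|apply: unitI_val_continuous].
Qed.

Lemma labelQ_near l0 q : 0 < (set_val (tauQ q) : R) < 1 ->
  \forall q' \near q, labelQ l0 q' = labelQ l0 q.
Proof.
move=> /(bumpQ_labelQ l0) bq.
have Fq : Filter (nbhs q) by exact: nbhs_filter.
apply: (@filterS _ _ Fq _ _ _ (near_gt0 (@bumpQ_continuous (labelQ l0 q)) bq)) => q'.
exact: bumpQ_gt0.
Qed.

End CellComplex.

(** * The rooted tree order *)

Section RootedTree.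
Variables (V : finType) (e : rel V) (u0 : V).

Definition reaches_root (v : V) (n : nat) : bool :=
  [exists p : n.-tuple V, path e v p && (last v p == u0)].

Definition depth (v : V) : nat :=
  if pselect (exists n, reaches_root v n) is left ex then ex_minn ex else 0%N.

Definition parent (v : V) : V :=
  odflt v [pick w | e v w & depth v == (depth w).+1].

(** w lies on the arc from the root to v. When w is deeper than v the difference
    of depths is 0, and the test reduces to w = v, which is false. *)
Definition anc (w v : V) : bool := iter (depth v - depth w) parent v == w.

Hypothesis tree_e : is_tree e.

Let e_sym : symmetric e. Proof. by case: tree_e. Qed.
Let e_irr : irreflexive e. Proof. by case: tree_e. Qed.

Lemma reaches_rootP (v : V) (p : seq V) :
  path e v p -> last v p = u0 -> reaches_root v (size p).
Proof.
move=> ep lp; apply/existsP; exists (in_tuple p) => /=.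
by rewrite ep lp eqxx.
Qed.

Lemma depth_spec (v : V) :
  reaches_root v (depth v) /\ forall n, reaches_root v n -> (depth v <= n)%N.
Proof.
rewrite /depth; case: pselect => [ex|[]]; first by case: ex_minnP.
have [_ _ conn _] := tree_e.
by have /connectP[p ep lp] := conn v u0; exists (size p); apply: reaches_rootP.
Qed.

Lemma depth_path (v : V) :
  exists p, [/\ path e v p, last v p = u0 & size p = depth v].
Proof.
have [/existsP[p /andP[ep /eqP lp]] _] := depth_spec v.
by exists p; rewrite size_tuple.
Qed.

Lemma depth_min (v : V) (p : seq V) :
  path e v p -> last v p = u0 -> (depth v <= size p)%N.
Proof. by move=> ep lp; have [_] := depth_spec v; apply; apply: reaches_rootP. Qed.

Lemma depth0 : depth u0 = 0%N.
Proof. by apply/eqP; rewrite -leqn0; apply: (@depth_min _ [::]). Qed.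

Lemma depth_eq0 (v : V) : (depth v == 0%N) = (v == u0).
Proof.
apply/eqP/eqP => [|->]; last exact: depth0.
by have [p [_ lp sp]] := depth_path v => v0; move: sp lp; rewrite v0 => /size0nil ->.
Qed.

Lemma depth_edge (v w : V) : e v w -> (depth v <= (depth w).+1)%N.
Proof.
move=> vw; have [p [ep lp <-]] := depth_path w.
by apply: (@depth_min _ (w :: p)) => //=; rewrite vw.
Qed.

Lemma parentP (v : V) : v != u0 -> e v (parent v) /\ depth v = (depth (parent v)).+1.
Proof.
move=> v0; rewrite /parent; case: pickP => [w /andP[vw /eqP]//|none] /=.
have [[|w p] [ep lp sp]] := depth_path v.
  by move: v0; rewrite -lp eqxx.
case/andP: ep => vw ep; move: (none w); rewrite vw /=.
rewrite eqn_leq depth_edge//= -sp ltnS.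
by rewrite (@depth_min _ p).
Qed.

Lemma parent_neq (v : V) : v != u0 -> parent v != v.
Proof. by move=> /parentP[]; case: eqP => // ->; rewrite e_irr. Qed.

Lemma parent0 : parent u0 = u0.
Proof. by rewrite /parent; case: pickP => //= w; rewrite depth0 andbF. Qed.

Lemma depth_parent (v : V) : depth (parent v) = (depth v).-1.
Proof.
have [->|/parentP[_ ->//]] := eqVneq v u0.
by rewrite parent0 depth0.
Qed.

Lemma parent_ind (P : V -> Prop) :
  P u0 -> (forall v, v != u0 -> P (parent v) -> P v) -> forall v, P v.
Proof.
move=> P0 PS v; move: {2}(depth v) (erefl (depth v)) => n.
elim: n v => [|n IH] v dv; first by move/eqP: dv; rewrite depth_eq0 => /eqP ->.
have v0 : v != u0 by rewrite -depth_eq0 dv.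
by apply: PS => //; apply: IH; rewrite depth_parent dv.
Qed.

(** The edges towards parents already connect the tree, so any other edge would
    close a simple path made of them into a cycle. *)
Lemma edge_parent (v w : V) : e v w -> w = parent v \/ v = parent w.
Proof.
move=> vw.
(* r joins each vertex to its parent; t discards the loop at the root. *)
pose r := [rel x y | (y == parent x) || (x == parent y)].
pose t := [rel x y | (x != y) && r x y].
have t_sym : symmetric t by move=> x y; rewrite /= eq_sym orbC.
have te : subrel t e.
  move=> x y /andP[xy /orP[/eqP yE|/eqP xE]].
    have [x0|/parentP[]] := eqVneq x u0; last by rewrite -yE.
    by move: xy; rewrite yE x0 parent0 eqxx.
  have [y0|/parentP[]] := eqVneq y u0; last by rewrite -xE e_sym.
  by move: xy; rewrite xE y0 parent0 eqxx.
have conn0 x : connect t x u0.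
  elim/parent_ind: x => [|x x0]; first exact: connect0.
  apply: connect_trans; apply: connect1.
  by rewrite /= eqxx andbT eq_sym parent_neq.
have /connectP[p tp lp] : connect t v w.
  apply: connect_trans (conn0 v) _.
  by rewrite (sym_connect_sym t_sym) conn0.
case/shortenP: tp lp => q tq uq _ lq.
have [//|vw_r] := boolP (r v w); first by case/orP=> /eqP; [left|right].
case: tree_e => _ _ _ acyclic.
have /acyclic : ucycle e (v :: q).
  by rewrite /ucycle uq andbT /cycle rcons_path (sub_path te) //= -lq e_sym.
case: q tq uq lq => [|a [|b q]] //= tq uq lq _.
  by move: vw; rewrite lq e_irr.
by move: tq vw_r; rewrite -lq /= andbT => /andP[_ ->].
Qed.

(** The recursion along parents, from which [parent_ind] yields all properties of
    the order. *)
Lemma anc_parent (w v : V) : anc w v = (w == v) || ((v != u0) && anc w (parent v)).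
Proof.
rewrite /anc; have [->|wv] := eqVneq w v; first by rewrite subnn eqxx.
have [v0|v0] /= := eqVneq v u0.
  by rewrite v0 depth0 sub0n /= -v0 eq_sym (negbTE wv).
have [_ dv] := parentP v0; rewrite dv.
case: (leqP (depth w) (depth (parent v))) => h; first by rewrite subSn// iterSr.
have -> : (depth (parent v) - depth w = 0)%N by apply/eqP; rewrite subn_eq0 ltnW.
have -> : ((depth (parent v)).+1 - depth w = 0)%N by apply/eqP; rewrite subn_eq0.
rewrite /= eq_sym (negbTE wv); apply/esym/eqP => pw.
by move: h; rewrite pw ltnn.
Qed.

Lemma anc_refl (v : V) : anc v v.
Proof. by rewrite anc_parent eqxx. Qed.

Lemma ancu0 (w : V) : anc w u0 = (w == u0).
Proof. by rewrite anc_parent eqxx orbF. Qed.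

Lemma anc_par (v : V) : anc (parent v) v.
Proof.
rewrite anc_parent anc_refl andbT orbC.
by case: eqVneq => //= ->; rewrite parent0.
Qed.

Lemma anc_root (v : V) : anc u0 v.
Proof.
elim/parent_ind: v => [|v v0 IH]; first exact: anc_refl.
by rewrite anc_parent v0 IH orbT.
Qed.

Lemma anc_depth (w v : V) : anc w v -> (depth w <= depth v)%N.
Proof.
elim/parent_ind: v => [|v v0 IH]; first by rewrite ancu0 => /eqP ->.
rewrite anc_parent v0 /= => /orP[/eqP->//|/IH]; rewrite depth_parent.
by move/leq_trans; apply; rewrite leq_pred.
Qed.

Lemma anc_depth_eq (w v : V) : anc w v -> (depth v <= depth w)%N -> w = v.
Proof.
rewrite anc_parent => /orP[/eqP//|/andP[v0 /anc_depth]].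
by rewrite depth_parent; have [_ ->] := parentP v0 => /= h1 /leq_trans/(_ h1); rewrite ltnn.
Qed.

Lemma anc_trans (b a c : V) : anc a b -> anc b c -> anc a c.
Proof.
move=> ab; elim/parent_ind: c => [|c c0 IH]; first by rewrite ancu0 => /eqP <-.
rewrite anc_parent c0 => /orP[/eqP <-//|/IH ac].
by rewrite anc_parent c0 ac orbT.
Qed.

Lemma anc_chain (c w w' : V) :
  anc w c -> anc w' c -> (depth w <= depth w')%N -> anc w w'.
Proof.
elim/parent_ind: c => [|c c0 IH].
  by rewrite !ancu0 => /eqP-> /eqP->; rewrite anc_refl.
rewrite (anc_parent w') c0 => wc /orP[/eqP->//|w'c] ww'.
move: wc; rewrite anc_parent c0 => /orP[/eqP wc|wc]; last exact: IH.
move: ww' (anc_depth w'c); rewrite wc depth_parent; have [_ ->] := parentP c0 => /=.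
by move=> /leq_trans h /h; rewrite ltnn.
Qed.

(** The last common vertex of two arcs, characterized through the vertices below
    it; this form is what minima of profiles use. *)
Lemma lca_ex (c c' : V) : exists v, forall w, anc w c && anc w c' = anc w v.
Proof.
elim/parent_ind: c => [|c c0 [v IH]].
  by exists u0 => w; rewrite ancu0; case: eqVneq => //= ->; rewrite anc_root.
have [cc'|cc'] := boolP (anc c c').
  by exists c => w; apply: andb_idr => /anc_trans; apply.
exists v => w; rewrite -IH (anc_parent w c) c0 /=.
by case: eqVneq => //= ->; rewrite (negbTE cc') andbF.
Qed.

Lemma anc_child (v c : V) : anc v c -> v != c ->
  exists c1, [/\ c1 != u0, parent c1 = v & anc c1 c].
Proof.
elim/parent_ind: c => [|c c0 IH]; first by rewrite ancu0 => ->.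
rewrite anc_parent c0 => /orP[->//|vc] _.
have [->|vpc] := eqVneq v (parent c); first by exists c; rewrite anc_refl.
have [c1 [? ? c1c]] := IH vc vpc; exists c1; split=> //.
by apply: anc_trans (anc_par c).
Qed.

Lemma anc_not_child (c : V) : c != u0 -> anc c (parent c) = false.
Proof.
move=> c0; apply/negP => /anc_depth; rewrite depth_parent.
by have [_ ->] := parentP c0; rewrite ltnn.
Qed.

(** * Labels as pairs of distinct siblings *)

Hypothesis root_u0 : univalent e u0.

(** A label (v, E, E') amounts to the pair of the upper ends of E and E', two
    distinct vertices with parent v. *)
Definition sibling_pair (c c' : V) :=
  [/\ c != u0, c' != u0, parent c = parent c' & c != c'].

Definition other_end (v : V) (E : {set V}) : V :=
  odflt v [pick w in E | w != v].

Lemma other_endE (v c : V) : c != v -> other_end v [set v; c]%SET = c.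
Proof.
move=> cv; rewrite /other_end; case: pickP => [w|/(_ c)].
  by rewrite !inE => /andP[/orP[/eqP->|/eqP->//]]; rewrite eqxx.
by rewrite !inE eqxx orbT cv.
Qed.

Lemma child_edge (c : V) : c != u0 -> e (parent c) c.
Proof.
by move=> /parentP[ec _]; case: tree_e => sym _ _ _; rewrite sym.
Qed.

Lemma incident_edgeP (v : V) (E : {set V}) :
  reflect (exists2 w, e v w & E = [set v; w]%SET) (E \in incident_edges e v).
Proof.
have [sym _ _ _] := tree_e.
apply: (iffP idP) => [|[w vw ->]]; last first.
  rewrite !inE eqxx andbT; apply/existsP; exists v; apply/existsP; exists w.
  by rewrite vw eqxx.
rewrite inE => /andP[/existsP[a /existsP[b /andP[ab /eqP->]]]].
rewrite !inE => /orP[/eqP->|/eqP->]; first by exists b.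
by exists a; rewrite 1?sym // finset.setUC.
Qed.

(** The edge to the parent is descending because depth is the length of a
    shortest path to the root; the edge to a child c is not, since a minimal
    path starting with it would give c a depth below that of its parent. *)
Lemma ascendingP (v : V) (E : {set V}) :
  ascending e u0 v E <-> exists c, [/\ c != u0, parent c = v & E = [set v; c]%SET].
Proof.
have [sym irr _ _] := tree_e; split.
  move=> [/incident_edgeP[w vw ->] ndesc].
  have wv : w != v by apply: contraTneq vw => ->; rewrite irr.
  have [w0|w0] := eqVneq w (parent v); last first.
    have [wv'|vE] := edge_parent vw; first by rewrite -wv' eqxx in w0.
    exists w; split=> //; apply: contraNneq wv => w0'.
    by rewrite vE w0' parent0.
  exfalso; apply: ndesc.
  have v0 : v != u0.
    by apply: contra wv => /eqP v0; rewrite w0 v0 parent0.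
  have [p [ep lp sp]] := depth_path  w.
  exists w, p; split=> //; split=> //=; first by rewrite vw.
  move=> q eq lq; rewrite sp w0 (depth_parent).
  by rewrite prednK ?lt0n ?depth_eq0// depth_min.
move=> [c [c0 pc ->]]; have cv : c != v by rewrite -pc eq_sym parent_neq.
split; first by apply/incident_edgeP; exists c => //; rewrite -pc child_edge.
move=> [w [p [[/= /andP[vw ep] lp mp] Ecw]]].
have wc : w = c.
  have : c \in [set v; w]%SET by rewrite -Ecw !inE eqxx orbT.
  by rewrite !inE (negbTE cv) => /eqP.
have [q [eq lq sq]] := depth_path  v.
have := mp _ eq lq; rewrite sq /= => lt1.
have := depth_min ep lp; rewrite wc.
have [_ ->] := parentP c0; rewrite pc => lt2.
by move: (ltn_trans lt1 lt2); rewrite ltnn.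
Qed.

(** Here univalence of the root enters: it fixes the image of the two 0-cells
    independently of the cell, and it keeps branching vertices off the root. *)
Lemma root_child_uniq (c c' : V) :
  c != u0 -> c' != u0 -> parent c = u0 -> parent c' = u0 -> c = c'.
Proof.
move=> c0 c'0 pc pc'; move: root_u0; rewrite /univalent /degree => /cards1P[E incE].
have inc d : d != u0 -> parent d = u0 -> [set u0; d]%SET = E.
  move=> d0 pd; apply/set1P; rewrite -incE; apply/incident_edgeP; exists d => //.
  by rewrite -{1}pd child_edge.
by rewrite -(other_endE c0) inc// -(inc c')// other_endE.
Qed.

Lemma sibling_parent_neq (c c' : V) : sibling_pair c c' -> parent c != u0.
Proof.
move=> [c0 c'0 pcc' cc']; apply: contra cc' => /eqP pc; apply/eqP.
by apply: root_child_uniq => //; rewrite -pcc'.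
Qed.

Lemma sibling_anc (c c' : V) : sibling_pair c c' -> ~~ anc c c'.
Proof.
move=> [c0 c'0 pcc' cc']; apply: contra cc' => cac'.
apply/eqP; apply: (anc_depth_eq cac').
by rewrite (parentP c'0).2 (parentP c0).2 pcc'.
Qed.

(** The parent of two siblings is not the root, so it has a descending edge
    besides the two ascending ones. *)
Lemma sibling_essential (c c' : V) : sibling_pair c c' -> essential e (parent c).
Proof.
move=> cc'; have pc0 := sibling_parent_neq cc'; case: (cc') => c0 c'0 pcc' neq.
set v := parent c in pc0 *.
have dc d : d != u0 -> parent d = v -> d != v by move=> d0 <-; rewrite eq_sym parent_neq.
have pv : parent v != v by apply: parent_neq _ pc0.
have ppv d : d != u0 -> parent d = v -> parent v != d.
  move=> d0 pd; apply/eqP => pvd; have := (parentP pc0).2; rewrite pvd.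
  rewrite (parentP d0).2 pd => /eqP; rewrite -[X in X == _]addn0 -[X in _ == X]addn2.
  by rewrite eqn_add2l.
have cv := dc _ c0 erefl; have c'v := dc _ c'0 (esym pcc').
have cE := other_endE cv; have c'E := other_endE c'v; have pvE := other_endE pv.
have E12 : [set v; c]%SET != [set v; c']%SET.
  by apply: contra neq => /eqP E; rewrite -cE E c'E.
have E13 : [set v; c]%SET != [set v; parent v]%SET.
  by apply: contra (ppv _ c0 erefl) => /eqP E; rewrite -pvE -E cE.
have E23 : [set v; c']%SET != [set v; parent v]%SET.
  by apply: contra (ppv _ c'0 (esym pcc')) => /eqP E; rewrite -pvE -E c'E.
have vc' : e v c' by rewrite /v pcc' child_edge.
rewrite /essential /degree.
have <- : #|[set [set v; c]; [set v; c']; [set v; parent v]]%SET| = 3%N.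
  rewrite finset.setUC cardsU1 !inE cards2 E12 negb_or.
  by rewrite !(eq_sym [set v; parent v]%SET) E13 E23.
apply: subset_leq_card; apply/fintype.subsetP => E.
have inc w : e v w -> [set v; w]%SET \in incident_edges e v.
  by move=> vw; apply/incident_edgeP; exists w.
move=> /setUP[/set2P[]|/set1P] ->; apply: inc => //; first exact: child_edge.
by have [] := parentP pc0.
Qed.

Lemma sibling_pair_exists :
  (exists v : V, essential e v) -> exists c c', sibling_pair c c'.
Proof.
move=> [v ess_v].
have v0 : v != u0.
  apply: contraTneq ess_v => ->; rewrite /essential.
  by move: root_u0; rewrite /univalent => /eqP ->.
(* At least two of the edges at v differ from the descending edge D. *)
pose D := [set v; parent v]%SET.
have cardA : (1 < #|incident_edges e v :\ D|)%N.
  have := cardsD1 D (incident_edges e v); have := ess_v.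
  rewrite /essential /degree => + cE; rewrite cE.
  by case: (D \in _); rewrite ?add1n ?add0n // => /ltnW.
have child E : E \in incident_edges e v :\ D ->
    exists c, [/\ c != u0, parent c = v & E = [set v; c]%SET].
  case/setD1P => ED /incident_edgeP[w vw EE]; exists w.
  have wp : w != parent v by apply: contra ED => /eqP wp; rewrite EE wp.
  have [wv|vw'] := edge_parent vw; first by rewrite wv eqxx in wp.
  split=> //; apply: contra wp => /eqP w0.
  by move: v0; rewrite vw' w0 parent0 eqxx.
have /card_gt1P[E [E' [/child[c [c0 pc EE]] /child[c' [c'0 pc' EE']] EE'n]]] := cardA.
exists c, c'; split=> //; first by rewrite pc.
by apply: contra EE'n => /eqP cc'; rewrite EE EE' cc'.
Qed.

Section LabelSiblings.
Variable l : label e u0.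

Definition label_child : V := other_end (set_val l).1.1 (set_val l).1.2.
Definition label_child' : V := other_end (set_val l).1.1 (set_val l).2.

Lemma label_childrenP :
  [/\ sibling_pair label_child label_child', parent label_child = (set_val l).1.1,
      (set_val l).1.2 = [set parent label_child; label_child]%SET &
      (set_val l).2 = [set parent label_child; label_child']%SET].
Proof.
rewrite /label_child /label_child'.
have := set_valP l; rewrite !set_valE; case: (\val l) => [[v E] E'] /= [_] /=.
move=> /ascendingP[c [c0 pc ->]] /ascendingP[c' [c'0 pc' ->]] cc'.
have cv : c != v by rewrite -pc eq_sym parent_neq.
have c'v : c' != v by rewrite -pc' eq_sym parent_neq.
rewrite !other_endE// pc; split=> //; split=> //; first by rewrite pc.
by apply: contra_notN cc' => /eqP ->.
Qed.

End LabelSiblings.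

Lemma label_children_inj (l l2 : label e u0) :
  label_child l = label_child l2 -> label_child' l = label_child' l2 -> l = l2.
Proof.
move=> lc lc'; have [_ v1 E1 E1'] := label_childrenP l.
have [_ v2 E2 E2'] := label_childrenP l2.
rewrite -lc -lc' in v2 E2 E2'.
have : set_val l = set_val l2.
  move: v1 E1 E1' v2 E2 E2'; case: (set_val l) (set_val l2) => [[a b] c] [[a' b'] c'] /=.
  by move=> <- -> -> <- -> ->.
by rewrite !set_valE => /val_inj.
Qed.

Lemma label_of_siblings (c c' : V) : sibling_pair c c' ->
  exists l : label e u0, label_child l = c /\ label_child' l = c'.
Proof.
move=> cc'; have := sibling_essential cc'; case: (cc') => c0 c'0 pcc' neq ess.
have cv : c != parent c by rewrite eq_sym parent_neq.
have c'v : c' != parent c by rewrite pcc' eq_sym parent_neq.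
have lab : label e u0 (parent c, [set parent c; c]%SET, [set parent c; c']%SET).
  split=> //=; [by apply/ascendingP; exists c|by apply/ascendingP; exists c'|].
  by move=> E; move: neq; rewrite -(other_endE cv) E other_endE// eqxx.
exists (@exist _ (fun x => x \in label e u0) _ (mem_set lab)).
by rewrite /label_child /label_child' !set_valE /= !other_endE.
Qed.

Lemma label_child_swap (l : label e u0) :
  label_child (label_swap l) = label_child' l /\
  label_child' (label_swap l) = label_child l.
Proof. by rewrite /label_child /label_child' !set_valE. Qed.

(** * Points of the tree as profiles *)

Variable R : realType.

Definition clamp (z : R) : R := Num.max 0 (Num.min 1 z).

Lemma clamp_ge0 z : 0 <= clamp z.
Proof. by rewrite le_max lexx. Qed.

Lemma clamp_le1 z : clamp z <= 1.
Proof. by rewrite ge_max ler01 ge_min lexx. Qed.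

Lemma clamp_id z : 0 <= z <= 1 -> clamp z = z.
Proof. by move=> /andP[z0 z1]; rewrite /clamp min_r// max_r. Qed.

Lemma clamp_ge1 z : 1 <= z -> clamp z = 1.
Proof. by move=> z1; rewrite /clamp min_l// max_r. Qed.

Lemma clamp_le0 z : z <= 0 -> clamp z = 0.
Proof. by move=> z0; rewrite /clamp max_l// ge_min z0 orbT. Qed.

Lemma clamp_homo : {homo clamp : x y / x <= y}.
Proof.
move=> x y xy; rewrite /clamp; have x1 : Num.min 1 x <= Num.min 1 y.
  by rewrite le_min !ge_min lexx xy orbT.
by rewrite ge_max le_max lexx/= le_max x1 orbT.
Qed.

Lemma clamp_min x y : Num.min (clamp x) (clamp y) = clamp (Num.min x y).
Proof.
have [xy|yx] := leP x y; first by rewrite min_l// clamp_homo.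
by rewrite min_r// clamp_homo// ltW.
Qed.

(** The profile of the point at distance r from the root on the arc to c: the
    edge below w is covered between the heights depth w - 1 and depth w. At the
    root the same formula gives the constant 1. *)
Definition prof (c : V) (r : R) (w : V) : R :=
  if anc w c then clamp (r - (depth w)%:R + 1) else 0.

(** Subtracts the constant contribution of the root. *)
Definition height (h : V -> R) : R := \sum_w h w - 1.

Lemma prof_ge0 c r w : 0 <= prof c r w.
Proof. by rewrite /prof; case: ifP => // _; apply: clamp_ge0. Qed.

Lemma prof_root c r : 0 <= r -> prof c r u0 = 1.
Proof.
by move=> r0; rewrite /prof anc_root clamp_ge1// depth0 subr0 lerDr.
Qed.

(** Up to the height of v, the arcs to v and to a vertex above v agree. *)
Lemma prof_trunc v c r : anc v c -> r <= (depth v)%:R -> prof c r = prof v r.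
Proof.
move=> vc rv; apply/funext => w; rewrite /prof.
have [wv|wv] := boolP (anc w v); first by rewrite (anc_trans wv vc).
case: ifP => // wc; rewrite clamp_le0//.
have : (depth v < depth w)%N by rewrite ltnNge; apply: contra wv; apply: anc_chain wc vc.
by rewrite -(ler_nat R) -natr1 => ?; lra.
Qed.

Lemma prof_parent c r w : c != u0 ->
  prof c r w = (if w == c then clamp (r - (depth c)%:R + 1) else 0) + prof (parent c) r w.
Proof.
move=> c0; rewrite /prof anc_parent c0 /=; case: eqVneq => [->|_]; last by rewrite add0r.
by rewrite anc_not_child// addr0.
Qed.

Lemma height_prof c r : 0 <= r -> height (prof c r) = Num.min r (depth c)%:R.
Proof.
move=> r0; rewrite /height; elim/parent_ind: c => [|c c0 IH].
  rewrite (bigD1 u0)//= prof_root// big1 ?addr0.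
    by rewrite subrr depth0 min_r.
  by move=> w w0; rewrite /prof ancu0 (negbTE w0).
under eq_bigr do rewrite prof_parent//.
rewrite big_split /= -big_mkcond big_pred1_eq -addrA IH.
have [_ ->] := parentP c0; rewrite -natr1.
set n := (depth _)%:R; rewrite /clamp.
have [rn|rn] := leP r n; have [r1|r1] := leP 1 (r - (n + 1) + 1);
  have [r2|r2] := leP r (n + 1); rewrite ?(max_r ler01) //; try lra.
- by rewrite max_l; lra.
- by rewrite max_r; lra.
Qed.

(** Two arcs run together until the shorter one ends or they branch, so the
    minimum of their profiles is again the profile of an arc. *)
Lemma prof_min (c c' v : V) r r' w :
  (forall w, anc w c && anc w c' = anc w v) ->
  Num.min (prof c r w) (prof c' r' w) = prof v (Num.min r r') w.
Proof.
move=> lca; rewrite /prof -lca; case: (anc w c); case: (anc w c') => //=.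
- by rewrite clamp_min; congr clamp; case: leP => ?; case: leP => ?; lra.
- by rewrite min_r// clamp_ge0.
- by rewrite min_l// clamp_ge0.
- by rewrite min_l.
Qed.

Lemma prof_inj_height c r c' r' : 0 <= r <= (depth c)%:R -> 0 <= r' <= (depth c')%:R ->
  prof c r = prof c' r' -> r = r'.
Proof.
move=> /andP[r0 rc] /andP[r'0 r'c'] E.
by have := congr1 height E; rewrite !height_prof// !min_l.
Qed.

Definition bary (h : V -> R) (v : V) : R :=
  h v - \sum_(c | (c != u0) && (parent c == v)) h c.

Definition upsum (x : V -> R) (w : V) : R := \sum_(v | anc w v) x v.

(** Both sums telescope: the vertices strictly above w are exactly the nonroot
    vertices whose parent is above w. *)
Lemma upsum_bary h : upsum (bary h) = h.
Proof.
apply/funext => w; rewrite /upsum /bary big_split /= (bigD1 w) ?anc_refl//=.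
rewrite -addrA sumrN -[RHS]addr0; congr (_ + _); apply/eqP; rewrite subr_eq0; apply/eqP.
rewrite (eq_bigl (fun v => (v != u0) && anc w (parent v))); last first.
  move=> v; rewrite anc_parent (eq_sym v w); case: eqVneq => [->|_] /=; last by rewrite andbT.
  by case: eqVneq => //= v0; rewrite anc_not_child.
rewrite (partition_big parent (fun v => anc w v)) => [|v /andP[]//].
apply: eq_bigr => v wv; apply: eq_bigl => c.
by case: (_ == u0) => //=; case: eqVneq => [->|]; rewrite ?andbF ?wv.
Qed.

(** x_v is recovered from the sum at v once the x_w for deeper w are known. *)
Lemma upsum_inj : injective upsum.
Proof.
move=> x y E; apply/funext => v; move: {2}(_ - _)%N (erefl (\max_w depth w - depth v)%N) => n.
elim/ltn_ind: n v => n IH v nE; have := congr1 (fun f => f v) E.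
rewrite /upsum !(bigD1 v (anc_refl v))//=.
rewrite [in X in _ = X -> _](eq_bigr x); first exact: addIr.
move=> w /andP[vw wv]; apply/esym.
have dvw : (depth v < depth w)%N.
  by rewrite ltnNge; apply: contra wv => /(anc_depth_eq vw) ->.
apply: (IH _ _ w erefl); rewrite -nE ltn_sub2l// (leq_trans dvw)//.
exact: (leq_bigmax w).
Qed.

(** c1 is the upper end of the edge on which the arc of length r to c ends, or c
    itself if r exceeds the depth of c. *)
Lemma prof_top c r : 0 <= r -> exists c1,
  [/\ anc c1 c, prof c r = prof c1 r & (depth c1)%:R < r + 1].
Proof.
move=> r0; elim/parent_ind: c => [|c c0 [c1 [c1c pE lt1]]].
  by exists u0; rewrite anc_refl depth0 ltr_pwDr.
have [rc|rc] := leP r (depth (parent c))%:R.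
  exists c1; split=> //; first exact: anc_trans (anc_par c).
  by rewrite -pE (prof_trunc (anc_par c)).
exists c; rewrite anc_refl; split=> //; have [_ ->] := parentP c0.
by rewrite -natr1 ltrD2r.
Qed.

Lemma bary_prof_ge0 c r v : 0 <= r -> 0 <= bary (prof c r) v.
Proof.
move=> r0; rewrite /bary subr_ge0.
have [vc|vc] := boolP (anc v c); last first.
  rewrite big1 ?prof_ge0// => d /andP[d0 /eqP pd]; rewrite /prof ifF//.
  by apply: contraNF vc => dc; rewrite -pd; apply: anc_trans (anc_par d) dc.
have [->|vnc] := eqVneq v c.
  rewrite big1 ?prof_ge0// => d /andP[d0 /eqP pd]; rewrite /prof ifF//.
  by rewrite -pd anc_not_child.
have [c1 [c10 pc1 c1c]] := anc_child vc vnc.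
rewrite (bigD1 c1) ?c10 ?pc1 ?eqxx//= big1 ?addr0.
  rewrite /prof vc c1c clamp_homo//; have [_ ->] := parentP c10.
  by rewrite pc1 -natr1; lra.
move=> d /andP[/andP[d0 /eqP pd] dc1]; rewrite /prof ifF//; apply: contraNF dc1 => dc.
apply/eqP; have ddc : depth d = depth c1.
  by have [_ ->] := parentP d0; have [_ ->] := parentP c10; rewrite pd pc1.
by apply: anc_depth_eq; rewrite ?ddc//; apply: anc_chain dc c1c _; rewrite ddc.
Qed.

Lemma realization_bary_prof c r : 0 <= r -> realization R e (bary (prof c r)).
Proof.
move=> r0; split; first by move=> v; apply: bary_prof_ge0.
  have := congr1 (fun f => f u0) (upsum_bary (prof c r)); rewrite /upsum prof_root// => <-.
  by apply: eq_bigl => v; rewrite anc_root.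
have [c1 [_ -> c1r]] := prof_top c r0.
have zero u : ~~ anc u c1 -> prof c1 r u = 0 by rewrite /prof => /negbTE ->.
have bary0 u : ~~ anc u c1 -> bary (prof c1 r) u = 0.
  move=> uc; rewrite /bary zero// big1 ?subr0// => d /andP[d0 /eqP pd]; rewrite zero//.
  by apply: contra uc => /(anc_trans (anc_par d)); rewrite pd.
have [c10|c10] := eqVneq c1 u0.
  exists u0, u0; rewrite eqxx; split=> // u uu0 _.
  by apply: bary0; rewrite c10 ancu0.
exists c1, (parent c1); rewrite (parentP c10).1 orbT; split=> // u uc up.
have [uc1|/bary0//] := boolP (anc u c1).
have up1 : anc u (parent c1) by move: uc1; rewrite anc_parent (negbTE uc) c10.
have [d [d0 pd dp]] := anc_child up1 up.
have dd : (depth d)%:R <= r.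
  rewrite -(lerD2r 1); apply: le_trans (ltW c1r); rewrite natr1 ler_nat.
  by have [_ ->] := parentP c10; rewrite ltnS anc_depth.
have dc1 := anc_trans dp (anc_par c1).
rewrite /bary (bigD1 d) ?d0 ?pd ?eqxx//= big1 ?addr0.
  have du : (depth u)%:R + 1 = (depth d)%:R :> R by rewrite (parentP d0).2 pd natr1.
  rewrite /prof uc1 dc1 (clamp_ge1 (z := r - (depth d)%:R + 1)); last by lra.
  by rewrite clamp_ge1 ?subrr//; lra.
move=> b /andP[/andP[b0 /eqP pb] bd]; rewrite zero//; apply: contra bd => bc1.
apply/eqP; have dbd : depth b = depth d.
  by have [_ ->] := parentP d0; have [_ ->] := parentP b0; rewrite pd pb.
by apply: anc_depth_eq; rewrite ?dbd//; apply: anc_chain bc1 dc1 _; rewrite dbd.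
Qed.

(** Among the at most two vertices that support x, the deeper one. *)
Lemma realization_top x : realization R e x -> exists2 c, 0 < x c &
  forall u, u != c -> u != parent c -> x u = 0.
Proof.
move=> [x0 x1 [v [w [vw xvw]]]].
have [c1 xc1] : exists c, 0 < x c.
  apply: contrapT => npos; move: x1.
  rewrite big1 => [/esym/eqP|u _]; first by rewrite oner_eq0.
  apply/eqP; rewrite eq_le x0 andbT leNgt; apply/negP => xu; apply: npos; by exists u.
have [c xc cmax] := @arg_maxnP _ c1 (fun c => 0 < x c) depth xc1.
exists c => // u uc up; apply/eqP; rewrite eq_le x0 andbT leNgt; apply/negP => xu.
have edge : e c u.
  have inE a : 0 < x a -> a = v \/ a = w.
    move=> xa; have [->|av] := eqVneq a v; [by left|].
    by have [->|aw] := eqVneq a w; [right|move: xa; rewrite xvw// ltxx].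
  have [cE|cE] := inE _ xc; have [uE|uE] := inE _ xu; rewrite ?cE ?uE ?eqxx// in uc *.
    by move: vw; rewrite eq_sym (negbTE uc).
  by rewrite e_sym; move: vw; rewrite (negbTE uc).
have [uE|cE] := edge_parent edge; first by rewrite uE eqxx in up.
have u0' : u != u0 by apply: contra uc => /eqP u0'; rewrite cE u0' parent0.
by have := cmax u xu; rewrite /geq /= (parentP u0').2 -cE ltnn.
Qed.

Lemma realization_prof x : realization R e x -> exists c r,
  [/\ 0 <= r <= (depth c)%:R, (depth c)%:R < r + 1 & upsum x = prof c r].
Proof.
move=> rx; have [x0 x1 _] := rx; have [c xc xz] := realization_top rx.
have [c0|c0] := eqVneq c u0.
  exists u0, 0; rewrite depth0 lexx add0r ltr01; split=> //.
  have xu0 u : u != u0 -> x u = 0.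
    by move=> uu0; apply: xz; rewrite c0 ?parent0.
  apply/funext => w; rewrite /prof ancu0; case: eqVneq => [->|w0].
    rewrite depth0 subr0 add0r clamp_ge1// -x1 /upsum.
    by apply: eq_bigl => v; rewrite anc_root.
  rewrite /upsum big1// => v wv; apply: xu0; apply: contraTneq wv => ->.
  by rewrite ancu0.
have pc := parent_neq c0; have [_ dc] := parentP c0.
have sumx (P : pred V) : \sum_(v | P v) x v =
    (if P c then x c else 0) + (if P (parent c) then x (parent c) else 0).
  rewrite big_mkcond (bigD1 c)//= (bigD1 (parent c))//= big1 ?addr0// => u /andP[uc up].
  by case: ifP => // _; apply: xz.
have xE : x c + x (parent c) = 1 by rewrite -x1 sumx.
have xp := x0 (parent c).
exists c, ((depth (parent c))%:R + x c); split.
- by rewrite dc -natr1 addr_ge0 ?ler0n ?(ltW xc)//= lerD2l; lra.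
- by rewrite dc -natr1 ltrD2r ltrDl.
apply/funext => w; rewrite /upsum sumx prof_parent//.
have -> : prof (parent c) ((depth (parent c))%:R + x c) w = if anc w (parent c) then 1 else 0.
  rewrite /prof; case: ifP => // wp; rewrite clamp_ge1//.
  have : ((depth w)%:R : R) <= (depth (parent c))%:R by rewrite ler_nat anc_depth.
  by lra.
rewrite (anc_parent w c) c0 /=; case: eqVneq => [->|wc] /=.
  rewrite anc_not_child// !addr0 clamp_id//; last by rewrite dc -natr1; lra.
  by rewrite dc -natr1; lra.
by case: ifP => _; rewrite ?add0r// ?addr0.
Qed.

(** * Two distinct points of the tree *)

Definition meet_height (hx hy : V -> R) : R := height (fun w => Num.min (hx w) (hy w)).

Definition excess (hx hy : V -> R) : R := height hx - meet_height hx hy.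

(** The length of the arc that joins the two points through their meet. *)
Definition tree_dist (hx hy : V -> R) : R := excess hx hy + excess hy hx.

Definition ratio (hx hy : V -> R) : R := excess hx hy / tree_dist hx hy.

(** The height of the first point on the cell at parameter t, when the branching
    vertex has height K. It rises with slope 2 (K + 1) to K + 1 at t = 1/2, and
    then falls to 1; the second point has the height at 1 - t. *)
Definition target (K t : R) : R := Num.min (2 * t * (K + 1)) (1 + (2 - 2 * t) * K).

Definition moved_height (s : R) (hx hy : V -> R) : R :=
  (1 - s) * height hx + s * target (meet_height hx hy) (ratio hx hy).

(** The clamp is the profile of the moved point at the vertices on the arc to the
    upper end of the edge of x, which are those with h_w > 0; this condition is
    not continuous in x. The bound by a large multiple of h_w imposes it
    continuously: it vanishes at the other vertices, and on the arc it stays above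
    the clamp, as [target_above] shows. *)
Definition moved (s : R) (hx hy : V -> R) (w : V) : R :=
  Num.min (clamp (moved_height s hx hy - (depth w)%:R + 1))
          ((1 + 4 / tree_dist hx hy) * hx w).

Lemma targetE K t : 0 <= K ->
  target K t = if t <= 1 / 2 then 2 * t * (K + 1) else 1 + (2 - 2 * t) * K.
Proof.
move=> K0; rewrite /target; have [t1|t1] := leP t (1 / 2).
  have tK : 0 <= (1 / 2 - t) * K by rewrite mulr_ge0//; lra.
  by rewrite min_l//; nra.
have tK : 0 <= (t - 1 / 2) * K by rewrite mulr_ge0//; lra.
by rewrite min_r//; nra.
Qed.

Lemma target0 K : 0 <= K -> target K 0 = 0.
Proof. by move=> K0; rewrite targetE// ifT; lra. Qed.

Lemma target1 K : 0 <= K -> target K 1 = 1.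
Proof. by move=> K0; rewrite targetE// ifF; [lra|apply/negbTE; rewrite -ltNge; lra]. Qed.

Lemma target_bounds K t : 0 <= K -> 0 <= t <= 1 -> 0 <= target K t <= K + 1.
Proof.
move=> K0 /andP[t0 t1]; have tK : 0 <= t * K by rewrite mulr_ge0.
have tK1 : 0 <= (1 - t) * K by rewrite mulr_ge0// subr_ge0.
rewrite targetE//; have [th|th] := leP t (1 / 2).
  by have thK : 0 <= (1 / 2 - t) * K by [rewrite mulr_ge0//; lra]; lra.
by have thK : 0 <= (t - 1 / 2) * K by [rewrite mulr_ge0//; lra]; lra.
Qed.

(** This makes the difference of the two target heights proportional to b - a,
    with the same sign as the difference of the original heights. *)
Lemma target_rev K t : 0 <= K -> target K (1 - t) - target K t = 1 - 2 * t.
Proof.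
move=> K0; rewrite !targetE//; case: leP => h1; case: leP => h2; try lra.
have -> : t = 1 / 2 by lra.
by lra.
Qed.

Lemma meet_height_sym hx hy : meet_height hx hy = meet_height hy hx.
Proof. by congr height; apply/funext => w; rewrite minC. Qed.

Lemma tree_dist_sym hx hy : tree_dist hx hy = tree_dist hy hx.
Proof. exact: addrC. Qed.

Lemma ratio_rev hx hy : tree_dist hx hy != 0 -> ratio hy hx = 1 - ratio hx hy.
Proof.
rewrite /ratio (tree_dist_sym hy) => d0; apply: (mulIf d0).
by rewrite divfK// mulrBl divfK// mul1r /tree_dist; lra.
Qed.

(** c is the upper end of the edge that carries the point, the root having
    height 0 and no such edge. *)
Definition placed (c : V) (r : R) := 0 <= r <= (depth c)%:R /\ (depth c)%:R < r + 1.

Definition is_lca (c c' v : V) := forall w, anc w c && anc w c' = anc w v.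

Lemma is_lca_sym c c' v : is_lca c c' v -> is_lca c' c v.
Proof. by move=> vP w; rewrite andbC. Qed.

Lemma meet_height_prof c r c' r' v : 0 <= r -> 0 <= r' -> is_lca c c' v ->
  meet_height (prof c r) (prof c' r') = Num.min (Num.min r r') (depth v)%:R.
Proof.
move=> r0 r'0 vP; rewrite -(@height_prof v); last by rewrite le_min r0.
by congr height; apply/funext => w; rewrite (prof_min _ _ _ vP).
Qed.

Lemma lca_siblings c c' v : is_lca c c' v -> v != c -> v != c' ->
  exists c1 c1', [/\ sibling_pair c1 c1', parent c1 = v, anc c1 c & anc c1' c'].
Proof.
move=> vP vc vc'; have := vP v; rewrite anc_refl => /andP[avc avc'].
have [c1 [c10 pc1 c1c]] := anc_child avc vc.
have [c1' [c1'0 pc1' c1'c']] := anc_child avc' vc'.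
exists c1, c1'; split=> //; split=> //; first by rewrite pc1.
apply/negP => /eqP cc; have := vP c1; rewrite c1c cc c1'c' /=.
by rewrite -pc1' anc_not_child.
Qed.

Lemma depth_sibling c c' : sibling_pair c c' -> depth c = depth c'.
Proof. by move=> [c0 c'0 pc _]; rewrite (parentP c0).2 (parentP c'0).2 pc. Qed.

Lemma sibling_separate c1 c1' c : sibling_pair c1 c1' -> anc c1 c -> anc c1' c -> False.
Proof.
move=> cc h1 h2; have /negP := sibling_anc cc; apply.
by apply: anc_chain h1 h2 _; rewrite (depth_sibling cc).
Qed.

Section Pair.
Variables (c c' v : V) (r r' : R).
Hypotheses (pl : placed c r) (pl' : placed c' r') (vP : is_lca c c' v).
Hypothesis neq : prof c r <> prof c' r'.

Local Notation m := (meet_height (prof c r) (prof c' r')).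
Local Notation d := (tree_dist (prof c r) (prof c' r')).
Local Notation t := (ratio (prof c r) (prof c' r')).
Local Notation k := ((depth v)%:R : R).

(** The three kinds of configurations: the first point lies on the arc to the
    second, or conversely, or both lie strictly above the branching vertex v. *)
Variant pair_position : Prop :=
| Below of r < r' & m = r & excess (prof c r) (prof c' r') = 0
    & d = r' - r & t = 0
| Above of r' < r & m = r' & excess (prof c' r') (prof c r) = 0
    & d = r - r' & t = 1
| Apart of k < r & k < r' & m = k & excess (prof c r) (prof c' r') = r - k
    & excess (prof c' r') (prof c r) = r' - k & d = r + r' - 2 * k
    & t = (r - k) / d.

Lemma pair_positionP : pair_position.
Proof.
have [/andP[r0 rc] _] := pl; have [/andP[r'0 r'c'] _] := pl'.
have k0 : 0 <= k by apply: ler0n.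
have E : excess (prof c r) (prof c' r') = r - m by rewrite /excess height_prof// min_l.
have E' : excess (prof c' r') (prof c r) = r' - m.
  by rewrite /excess height_prof// min_l// meet_height_sym.
have dE : d = r + r' - 2 * m by rewrite /tree_dist E E'; lra.
have tE : t = (r - m) / d by rewrite /ratio E.
have mE : m = Num.min (Num.min r r') k by rewrite (meet_height_prof r0 r'0 vP).
have := vP v; rewrite anc_refl => /andP[vc vc'].
have noteq : ~ (r = r' /\ r <= k).
  by move=> [rr' rk]; apply: neq; rewrite -rr' (prof_trunc vc rk) (prof_trunc vc' rk).
have [rr'|rr'] := leP r r'; have [rk|rk] := leP r k; have [r'k|r'k] := leP r' k.
- have lt : r < r' by rewrite lt_neqAle rr' andbT; apply/eqP => h; apply: noteq.
  have mE' : m = r by rewrite mE !min_l.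
  by apply: Below; rewrite // ?E ?dE ?tE ?mE'; lra.
- have mE' : m = r by rewrite mE !min_l.
  by apply: Below; rewrite // ?E ?dE ?tE ?mE'; lra.
- by exfalso; lra.
- have mE' : m = k by rewrite mE (min_l rr') min_r// ltW.
  by apply: Apart; rewrite // ?E ?E' ?tE ?dE ?mE'; lra.
- have mE' : m = r' by rewrite mE (min_r (ltW rr')) min_l//.
  have dd : d = r - r' by rewrite dE mE'; lra.
  apply: Above; rewrite // ?E' ?tE ?mE' ?dd; first lra.
  by rewrite divff// subr_eq0; apply/eqP; lra.
- by exfalso; lra.
- have mE' : m = r' by rewrite mE (min_r (ltW rr')) min_l//.
  have dd : d = r - r' by rewrite dE mE'; lra.
  apply: Above; rewrite // ?E' ?tE ?mE' ?dd; first lra.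
  by rewrite divff// subr_eq0; apply/eqP; lra.
- have mE' : m = k by rewrite mE (min_r (ltW rr')) min_r// ltW.
  by apply: Apart; rewrite // ?E ?E' ?tE ?dE ?mE'; lra.
Qed.

Lemma tree_dist_gt0 : 0 < d.
Proof. by case: pair_positionP => *; lra. Qed.

Lemma meet_height_ge0 : 0 <= m.
Proof.
have [/andP[r0 _] _] := pl; have [/andP[r'0 _] _] := pl'.
by case: pair_positionP => [_ ->|_ ->|_ _ ->] //; rewrite ler0n.
Qed.

Lemma ratio_bounds : 0 <= t <= 1.
Proof.
have d0 := tree_dist_gt0.
case: pair_positionP => [_ _ _ _ ->|_ _ _ _ ->|kr kr' _ _ _ dE ->]; try lra.
by rewrite divr_ge0 ?ler_pdivrMr//=; lra.
Qed.

(** The branching vertex is not the root, because the root has a single child;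
    hence 1 <= k. *)
Lemma apart_depth : k < r -> k < r' ->
  [/\ k + 1 <= (depth c)%:R, k + 1 <= (depth c')%:R & 1 <= k].
Proof.
have [/andP[r0 rc] _] := pl; have [/andP[r'0 r'c'] _] := pl' => kr kr'.
have vc : (depth v < depth c)%N by rewrite -(ltr_nat R) ; lra.
have vc' : (depth v < depth c')%N by rewrite -(ltr_nat R) ; lra.
rewrite !natr1 !ler_nat; split=> //.
have vnc : v != c by apply: contraTneq vc => ->; rewrite ltnn.
have vnc' : v != c' by apply: contraTneq vc' => ->; rewrite ltnn.
have [c1 [c1' [cc pc _ _]]] := lca_siblings vP vnc vnc'.
by rewrite ler1n lt0n depth_eq0 -pc (sibling_parent_neq cc).
Qed.

Lemma target_le_depth : 0 <= target m t <= (depth c)%:R.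
Proof.
have [/andP[r0 rc] _] := pl; have [/andP[r'0 r'c'] _] := pl'.
have m0 := meet_height_ge0.
have /andP[-> /=] := target_bounds m0 ratio_bounds.
case: pair_positionP => [_ _ _ _ ->|h _ _ _ ->|kr kr' -> _ _ _ _].
- by rewrite target0.
- rewrite target1// => _; rewrite ler1n lt0n; apply/negP => /eqP d0.
  by move: rc; rewrite d0; lra.
by have [? _ _] := apart_depth kr kr'; move=> ?; lra.
Qed.

(** A point is asked to move up only inside the edge where it lies, and only if
    the part of this edge below it is at least a quarter of the distance of the
    two points: 2 t (k + 1) > k and 1 <= k imply t > 1/4. *)
Lemma target_above : r < target m t -> d <= 4 * (r - (depth c)%:R + 1).
Proof.
have [/andP[r0 rc] rc1] := pl; have [/andP[r'0 r'c'] _] := pl'.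
have m0 := meet_height_ge0; have /andP[_ tb] := target_bounds m0 ratio_bounds.
have d0 := tree_dist_gt0.
case: pair_positionP => [_ _ _ _ ->|h _ _ -> ->|kr kr' mE _ _ dE tE].
- by rewrite target0//; lra.
- rewrite target1// => r1; have : (depth c < 2)%N by rewrite -(ltr_nat R); lra.
  by rewrite ltnS -(ler_nat R) => ?; lra.
have [kc _ k1] := apart_depth kr kr'; move: tb; rewrite mE => tb rt.
have : (depth c < (depth v).+2)%N by rewrite -(ltr_nat R) -!natr1 ; lra.
rewrite ltnS -(ler_nat R) -natr1  => kc'.
have cE : (depth c)%:R = k + 1 by apply/eqP; rewrite eq_le kc kc'.
have t4 : 1 / 4 < t.
  rewrite ltNge; apply/negP => t4; have : target k t <= 2 * t * (k + 1) by rewrite ge_min lexx.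
  nra.
by move: t4; rewrite tE ltr_pdivlMr// cE; lra.
Qed.

(** The bound by a multiple of h_w in [moved] is inactive on the arc, so the moved
    point is the point of the intended height. *)
Lemma moved_prof (s : R) : 0 <= s <= 1 ->
  let r_s := moved_height s (prof c r) (prof c' r') in
  moved s (prof c r) (prof c' r') = prof c r_s /\ 0 <= r_s <= (depth c)%:R.
Proof.
move=> /andP[s0 s1] r_s.
have [/andP[r0 rc] rc1] := pl; have /andP[t0 tc] := target_le_depth.
have rsE : r_s = (1 - s) * r + s * target m t.
  by rewrite /r_s /moved_height height_prof// min_l.
split; last by rewrite rsE; nra.
have d0 := tree_dist_gt0.
have sl1 : 0 <= 4 / d by rewrite divr_ge0// ltW.
apply/funext => w; rewrite /moved -/r_s /prof; case: ifP => wc; last first.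
  by rewrite mulr0 min_r// clamp_ge0.
apply: min_l; have [->|wnc] := eqVneq w c; last first.
  rewrite (clamp_ge1 (z := r - _ + _)); first by rewrite mulr1 (le_trans (clamp_le1 _))//; lra.
  have : (depth w < depth c)%N.
    by rewrite ltnNge; apply: contra wnc => h; rewrite (anc_depth_eq wc h).
  by rewrite -(ler_nat R) -natr1; lra.
have th : 0 <= r - (depth c)%:R + 1 <= 1 by lra.
rewrite (clamp_id th) mulrDl mul1r.
have [rt|rt] := leP (target m t) r.
  apply: (@le_trans _ _ (clamp (r - (depth c)%:R + 1))).
    by apply: clamp_homo; rewrite rsE; nra.
  by rewrite clamp_id//; nra.
apply: (le_trans (clamp_le1 _)); have h := target_above rt.
have : 1 <= 4 / d * (r - (depth c)%:R + 1) by rewrite mulrAC ler_pdivlMr// mul1r.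
by lra.
Qed.

End Pair.

(** At a collision the heights are equal and at most k. Their difference is
    (1 - 2 t) ((1 - s) d + s), with d the distance, so t = 1/2 and a = b; but then
    both heights interpolate between heights above k. *)
Lemma moved_neq c c' v r r' (s : R) :
  placed c r -> placed c' r' -> is_lca c c' v -> prof c r <> prof c' r' -> 0 <= s <= 1 ->
  moved s (prof c r) (prof c' r') <> moved s (prof c' r') (prof c r).
Proof.
move=> pl pl' vP neq s01; have vP' := is_lca_sym vP; have neq' := not_eq_sym neq.
have [-> b] := moved_prof pl pl' vP neq s01.
have [-> b'] := moved_prof pl' pl vP' neq' s01.
have [/andP[r0 rc] _] := pl; have [/andP[r'0 rc'] _] := pl'.
have d0 := tree_dist_gt0 pl pl' vP neq; have m0 := meet_height_ge0 pl pl' vP neq.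
have tr := ratio_rev (lt0r_neq0 d0).
have rsE : moved_height s (prof c r) (prof c' r') =
    (1 - s) * r + s * target (meet_height (prof c r) (prof c' r'))
      (ratio (prof c r) (prof c' r')).
  by rewrite /moved_height height_prof// min_l.
have rsE' : moved_height s (prof c' r') (prof c r) =
    (1 - s) * r' + s * target (meet_height (prof c r) (prof c' r'))
      (1 - ratio (prof c r) (prof c' r')).
  by rewrite /moved_height height_prof// min_l// meet_height_sym tr.
move=> E; have rr := prof_inj_height b b' E.
have /andP[rs0 rsc] := b.
have rsk : moved_height s (prof c r) (prof c' r') <= (depth v)%:R.
  have /andP[rs'0 _] := b'; have := meet_height_prof rs0 rs'0 vP.
  rewrite -E /meet_height; under [X in height X]eq_fun do rewrite minxx.
  by rewrite height_prof// (min_l rsc) -rr minxx => ->; rewrite ge_min lexx orbT.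
have := target_rev (ratio (prof c r) (prof c' r')) m0.
move: rr rsk; rewrite rsE' rsE => rr rsk trev.
have k0 : 0 <= (depth v)%:R :> R by [].
set m := meet_height _ _ in rr rsk trev m0 *; set t := ratio _ _ in rr rsk trev *.
set d := tree_dist _ _ in d0 *.
have td : t * d = r - m by rewrite divfK ?gt_eqF// /excess height_prof// min_l.
have dE : d = r + r' - 2 * m.
  by rewrite /d /tree_dist /excess !height_prof// !min_l// (meet_height_sym (prof c' r')) -/m; lra.
have pp := pair_positionP pl pl' vP neq; have [s0 s1] := andP s01; clear E neq neq'.
(* The factor by which the motion scales the difference of the heights. *)
have pos : 0 < (1 - s) * d + s.
  have [->|sn1] := eqVneq s 1; first by rewrite subrr mul0r add0r.
  by rewrite ltr_pwDl// mulr_gt0// subr_gt0 lt_neqAle sn1.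
have /eqP : (1 - 2 * t) * ((1 - s) * d + s) = 0.
  have -> : (1 - 2 * t) * ((1 - s) * d + s) =
      (1 - s) * (d - 2 * (t * d)) + s * (1 - 2 * t) by ring.
  by rewrite -trev td dE; move: rr; lra.
rewrite mulf_eq0 (gt_eqF pos) orbF => /eqP t2; have {}t2 : t = 1 / 2 by lra.
have rrE : r = r' by move: td; rewrite t2; lra.
have := pp; case=> [|lt _ _ _ _|kr kr' mE _ _ _ _].
- by rewrite rrE ltxx.
- by move: lt; rewrite rrE ltxx.
have {}mE : m = (depth v)%:R by [].
move: rsk; rewrite t2 mE targetE// ifT//.
by nra.
Qed.

(** A point given by an arc may be carried by a lower edge of that arc. *)
Lemma prof_placed c r : 0 <= r <= (depth c)%:R ->
  exists c0, [/\ anc c0 c, placed c0 r & prof c r = prof c0 r].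
Proof.
move=> /andP[r0 rc]; have [c0 [c0c pE lt]] := prof_top c r0; exists c0; split=> //.
split=> //; rewrite r0 /=; have := congr1 height pE; rewrite !height_prof// min_l// => ->.
by rewrite ge_min lexx orbT.
Qed.

Lemma prof_gt0_anc c r w : 0 < prof c r w -> anc w c.
Proof. by rewrite /prof; case: ifP => // _; rewrite ltxx. Qed.

(** Two arcs branch at one vertex only, and there through one pair of children. *)
Lemma sibling_uniq a a' b b' c c' : sibling_pair a a' -> sibling_pair b b' ->
  anc a c -> anc b c -> anc a' c' -> anc b' c' -> a = b /\ a' = b'.
Proof.
wlog dab : a a' b b' / (depth a <= depth b)%N.
  move=> H aa bb ac bc ac' bc'; case/orP: (leq_total (depth a) (depth b)) => h; first exact: H.
  by have [-> ->] := H _ _ _ _ h bb aa bc ac bc' ac'.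
move=> aa bb ac bc ac' bc'; have ab := anc_chain ac bc dab.
have [bE|bne] := eqVneq a b.
  split=> //; have d' : depth a' = depth b'.
    by rewrite -(depth_sibling aa) -(depth_sibling bb) bE.
  by apply: anc_depth_eq; rewrite ?d'//; apply: anc_chain ac' bc' _; rewrite d'.
exfalso; apply: (sibling_separate aa _ ac'); case: (bb) => b0 b'0 pb _.
move: ab; rewrite anc_parent (negbTE bne) b0 pb /= => /anc_trans; apply.
by apply: anc_trans (anc_par b') bc'.
Qed.

(** Both are the unique neighbour of the root. *)
Lemma prof_one c c' : c != u0 -> c' != u0 -> prof c 1 = prof c' 1.
Proof.
have top d : d != u0 -> exists2 d1, d1 != u0 /\ parent d1 = u0 & prof d 1 = prof d1 1.
  move=> d0; have ud : u0 != d by rewrite eq_sym.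
  have [d1 [d10 pd d1d]] := anc_child (anc_root d) ud; exists d1 => //.
  by apply: prof_trunc => //; rewrite (parentP d10).2 pd depth0.
move=> /top[d [d0 pd] ->] /top[d' [d'0 pd'] ->]; by rewrite (root_child_uniq d0 d'0 pd pd').
Qed.

Definition is_position (h : V -> R) := exists c r, placed c r /\ h = prof c r.

Definition in_cell (l : label e u0) (hx hy : V -> R) :=
  (0 < hx (label_child l)) && (0 < hy (label_child' l)).

(** The first point of the configuration at parameter t of the cell l; the second
    one is the first point of the swapped cell at 1 - t. *)
Definition cell_profile (l : label e u0) (t : R) : V -> R :=
  prof (label_child l) (target (depth (parent (label_child l)))%:R t).

Lemma is_position_prof c r : 0 <= r <= (depth c)%:R -> is_position (prof c r).
Proof. by move=> /prof_placed[c0 [_ pl ->]]; exists c0, r. Qed.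

Lemma cell_height (l : label e u0) (t : R) : 0 <= t <= 1 ->
  0 <= target (depth (parent (label_child l)))%:R t <= (depth (label_child l))%:R.
Proof.
move=> t01; have [[c0 _ _ _] _ _ _] := label_childrenP l.
by rewrite (parentP c0).2 -natr1 target_bounds.
Qed.

Lemma cell_position l t : 0 <= t <= 1 -> is_position (cell_profile l t).
Proof. by move=> t01; apply/is_position_prof/cell_height. Qed.

Lemma cell_parent_swap (l : label e u0) :
  parent (label_child (label_swap l)) = parent (label_child l).
Proof.
by have [-> _] := label_child_swap l; have [[_ _ -> _] _ _ _] := label_childrenP l.
Qed.

Lemma unit_rev (t : R) : 0 <= t <= 1 -> 0 <= 1 - t <= 1.
Proof. by lra. Qed.

Lemma cell_neq l t : 0 <= t <= 1 -> cell_profile l t <> cell_profile (label_swap l) (1 - t).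
Proof.
move=> t01 E; have h1 := cell_height l t01; have h2 := cell_height (label_swap l) (unit_rev t01).
have rr := prof_inj_height h1 h2 E; move: rr; rewrite cell_parent_swap => rr.
have k0 : 0 <= (depth (parent (label_child l)))%:R :> R by [].
have := target_rev t k0; rewrite -rr => t2; have {}t2 : t = 1 / 2 by lra.
have [cc _ _ _] := label_childrenP l; have [sc _] := label_child_swap l.
have := congr1 (fun f => f (label_child l)) E; rewrite /cell_profile sc /prof anc_refl.
rewrite (negbTE (sibling_anc cc)) t2 targetE// ifT// clamp_ge1 ?oner_neq0//.
  by move/eqP; rewrite oner_eq0.
have dc : (depth (label_child l))%:R = (depth (parent (label_child l)))%:R + 1 :> R.
  by case: cc => c0 _ _ _; rewrite natr1 -(parentP c0).2.
by rewrite dc; lra.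
Qed.

Lemma cell_profile0 l : cell_profile l 0 = prof u0 0.
Proof.
by rewrite /cell_profile target0//; apply: prof_trunc; rewrite ?anc_root// depth0.
Qed.

Lemma cell_profile1 l l2 : cell_profile l 1 = cell_profile l2 1.
Proof.
rewrite /cell_profile !target1//; apply: prof_one.
  by have [[]] := label_childrenP l.
by have [[]] := label_childrenP l2.
Qed.

Section PositionPair.
Variables (hx hy : V -> R).
Hypotheses (px : is_position hx) (py : is_position hy) (neq : hx <> hy).

Lemma position_tree_dist_gt0 : 0 < tree_dist hx hy.
Proof.
move: px py neq => [c [r [pl ->]]] [c' [r' [pl' ->]]] n; have [v vP] := lca_ex c c'.
exact: tree_dist_gt0 pl pl' vP n.
Qed.

Lemma position_ratio : 0 <= ratio hx hy <= 1.
Proof.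
move: px py neq => [c [r [pl ->]]] [c' [r' [pl' ->]]] n; have [v vP] := lca_ex c c'.
exact: ratio_bounds pl pl' vP n.
Qed.

Lemma moved_position s : 0 <= s <= 1 -> is_position (moved s hx hy).
Proof.
move: px py neq => [c [r [pl ->]]] [c' [r' [pl' ->]]] n s01; have [v vP] := lca_ex c c'.
by have [-> /is_position_prof] := moved_prof pl pl' vP n s01.
Qed.

Lemma moved_distinct s : 0 <= s <= 1 -> moved s hx hy <> moved s hy hx.
Proof.
move: px py neq => [c [r [pl ->]]] [c' [r' [pl' ->]]] n; have [v vP] := lca_ex c c'.
exact: moved_neq pl pl' vP n.
Qed.

Lemma moved0 : moved 0 hx hy = hx.
Proof.
move: px py neq => [c [r [pl ->]]] [c' [r' [pl' ->]]] n; have [v vP] := lca_ex c c'.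
have h01 : 0 <= (0 : R) <= 1 by rewrite lexx ler01.
have [-> _] := moved_prof pl pl' vP n h01.
have [/andP[r0 rc] _] := pl.
by rewrite /moved_height subr0 mul1r mul0r addr0 height_prof// min_l.
Qed.

Lemma in_cell_inj l l2 : in_cell l hx hy -> in_cell l2 hx hy -> l = l2.
Proof.
move: px py => [c [r [_ ->]]] [c' [r' [_ ->]]].
move=> /andP[/prof_gt0_anc a1 /prof_gt0_anc a2] /andP[/prof_gt0_anc b1 /prof_gt0_anc b2].
have [s1 _ _ _] := label_childrenP l; have [s2 _ _ _] := label_childrenP l2.
have [E E'] := sibling_uniq s1 s2 a1 b1 a2 b2.
exact: label_children_inj.
Qed.

Lemma in_cell_ex : 0 < ratio hx hy < 1 -> exists l, in_cell l hx hy.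
Proof.
move: px py neq => [c [r [pl ->]]] [c' [r' [pl' ->]]] n; have [v vP] := lca_ex c c'.
case: (pair_positionP pl pl' vP n) => [_ _ _ _ ->|_ _ _ _ ->|kr kr' _ _ _ _ _ _].
- by rewrite ltxx.
- by rewrite ltxx andbF.
have [kc kc' _] := apart_depth pl pl' vP kr kr'.
have vc : v != c by apply/eqP => E; move: kc; rewrite E; lra.
have vc' : v != c' by apply/eqP => E; move: kc'; rewrite E; lra.
have [c1 [c1' [cc pc1 c1c c1c']]] := lca_siblings vP vc vc'.
have [l [lc lc']] := label_of_siblings cc; exists l.
have dc : (depth c1)%:R = (depth v)%:R + 1 :> R.
  by case: cc => c10 _ _ _; rewrite (parentP c10).2 pc1 natr1.
have dc' : (depth c1')%:R = (depth v)%:R + 1 :> R by rewrite -(depth_sibling cc).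
rewrite /in_cell lc lc' /prof c1c c1c' dc dc' /clamp !lt_max !lt_min ltr01 !ltxx /=.
by apply/andP; split; lra.
Qed.

(** The end of the motion depends on the configuration only through its image in
    the complex: where the arcs branch, the target heights are functions of t and
    k, and otherwise the target is the configuration of a 0-cell. *)
Lemma moved1 l : (0 < ratio hx hy < 1 -> in_cell l hx hy) ->
  moved 1 hx hy = cell_profile l (ratio hx hy).
Proof.
move: px py neq => [c [r [pl ->]]] [c' [r' [pl' ->]]] n; have [v vP] := lca_ex c c'.
have h01 : 0 <= (1 : R) <= 1 by rewrite lexx ler01.
have m0 := meet_height_ge0 pl pl' vP n; have d0 := tree_dist_gt0 pl pl' vP n.
have [-> _] := moved_prof pl pl' vP n h01; rewrite /moved_height subrr mul0r add0r mul1r.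
have [/andP[r0 rc] _] := pl; have [/andP[r'0 rc'] _] := pl'.
have tb := target_bounds m0 (ratio_bounds pl pl' vP n).
case: (pair_positionP pl pl' vP n) => [_ _ _ _ ->|lt _ _ _ ->|kr kr' mE _ _ dE tE] cell.
- by rewrite cell_profile0 target0//; apply: prof_trunc; rewrite ?anc_root// depth0.
- rewrite target1// /cell_profile target1//.
  apply: prof_one; last by have [[]] := label_childrenP l.
  by apply/eqP => cE; move: rc; rewrite cE depth0; lra.
have /andP[cx cy] : in_cell l (prof c r) (prof c' r').
  by apply: cell; rewrite tE divr_gt0 ?ltr_pdivrMr//; lra.
have [cc _ _ _] := label_childrenP l; have [c10 c1'0 pc _] := cc.
have vE : parent (label_child l) = v.
  have pv : anc (parent (label_child l)) v.
    rewrite -vP (anc_trans (anc_par _) (prof_gt0_anc cx)) pc.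
    by rewrite (anc_trans (anc_par _) (prof_gt0_anc cy)).
  apply: (anc_depth_eq pv); rewrite leqNgt; apply/negP => lt.
  have := vP v; rewrite anc_refl => /andP[vc vc'].
  apply: (sibling_separate cc _ (prof_gt0_anc cy)); apply: anc_trans vc'.
  by apply: anc_chain (prof_gt0_anc cx) vc _; rewrite (parentP c10).2.
rewrite /cell_profile vE -mE; apply: prof_trunc; first exact: prof_gt0_anc cx.
by rewrite (parentP c10).2 vE -natr1 -mE; case/andP: tb.
Qed.

End PositionPair.

Lemma cell_ratio0 l : ratio (cell_profile l 0) (cell_profile (label_swap l) 1) = 0.
Proof.
rewrite cell_profile0 /ratio /excess /cell_profile target1//.
have [v vP] := lca_ex u0 (label_child (label_swap l)).
rewrite height_prof ?lexx// (meet_height_prof (lexx 0) ler01 vP) depth0 minxx.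
by rewrite (min_l (@ler01 R)) min_l// subrr mul0r.
Qed.

Lemma cell_ratio1 l : ratio (cell_profile l 1) (cell_profile (label_swap l) 0) = 1.
Proof.
have h01 : 0 <= (1 : R) <= 1 by rewrite lexx ler01.
have n := @cell_neq l 1 h01; rewrite subrr in n.
rewrite ratio_rev.
  by have := cell_ratio0 (label_swap l); rewrite label_swapK => ->; rewrite subr0.
rewrite gt_eqF// position_tree_dist_gt0//; last exact: not_eq_sym.
all: by apply: cell_position; rewrite lexx ler01.
Qed.

Lemma in_cell_cell l l2 t :
  in_cell l2 (cell_profile l t) (cell_profile (label_swap l) (1 - t)) ->
  l2 = l.
Proof.
move=> /andP[/prof_gt0_anc a /prof_gt0_anc]; have [-> _] := label_child_swap l => b.
have [s1 _ _ _] := label_childrenP l; have [s2 _ _ _] := label_childrenP l2.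
have [E E'] := sibling_uniq s2 s1 a (anc_refl _) b (anc_refl _).
exact: label_children_inj.
Qed.

(** * The two maps and the two homotopies *)

Local Notation C := (set_type (conf2 R e)).
Local Notation I := (set_type (unitI R)).
Local Notation Q := (QGamma R e u0).

Definition profile1 (p : C) : V -> R := upsum (set_val (set_val p).1).
Definition profile2 (p : C) : V -> R := upsum (set_val (set_val p).2).

Lemma profile1_swap p : profile1 (conf2_swap R e p) = profile2 p.
Proof. by rewrite /profile1 set_valE. Qed.

Lemma profile2_swap p : profile2 (conf2_swap R e p) = profile1 p.
Proof. by rewrite /profile2 set_valE. Qed.

Lemma realization_position (x : realization R e) : is_position (upsum (set_val x)).
Proof.
have [c [r [rc lt ->]]] := realization_prof (set_valP x).
by exists c, r.
Qed.

Lemma upsum_val_inj (x y : realization R e) :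
  upsum (set_val x) = upsum (set_val y) -> x = y.
Proof. by move=> /upsum_inj; rewrite !set_valE => /val_inj. Qed.

Lemma profile1_position p : is_position (profile1 p).
Proof. exact: realization_position. Qed.

Lemma profile2_position p : is_position (profile2 p).
Proof. exact: realization_position. Qed.

Lemma profile_neq p : profile1 p <> profile2 p.
Proof. by move=> /upsum_val_inj; apply: (set_valP p). Qed.

Lemma profile_inj p q : profile1 p = profile1 q -> profile2 p = profile2 q -> p = q.
Proof.
move=> /upsum_val_inj E1 /upsum_val_inj E2.
have : set_val p = set_val q.
  by rewrite (surjective_pairing (set_val p)) E1 E2 -surjective_pairing.
by rewrite !set_valE => /val_inj.
Qed.

Lemma position_realization h : is_position h -> realization R e (bary h).
Proof. by move=> [c [r [[/andP[r0 _] _] ->]]]; apply: realization_bary_prof. Qed.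

Definition point_of h (ph : is_position h) : realization R e :=
  @exist _ (fun x => x \in realization R e) _ (mem_set (position_realization ph)).

Lemma conf_of_subproof h h' (ph : is_position h) (ph' : is_position h') :
  h <> h' -> conf2 R e (point_of ph, point_of ph').
Proof.
move=> neq /= /(congr1 (fun x : realization R e => upsum (set_val x))).
by rewrite !set_valE /= !upsum_bary.
Qed.

Definition conf_of h h' (ph : is_position h) (ph' : is_position h') (neq : h <> h') : C :=
  @exist _ (fun p => p \in conf2 R e) _ (mem_set (@conf_of_subproof h h' ph ph' neq)).

Lemma profile1_conf_of h h' ph ph' neq : profile1 (@conf_of h h' ph ph' neq) = h.
Proof. by rewrite /profile1 !set_valE /= upsum_bary. Qed.

Lemma profile2_conf_of h h' ph ph' neq : profile2 (@conf_of h h' ph ph' neq) = h'.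
Proof. by rewrite /profile2 !set_valE /= upsum_bary. Qed.

Lemma continuous_conf_of (Z : topologicalType) (h h' : Z -> V -> R)
    (ph : forall z, is_position (h z)) (ph' : forall z, is_position (h' z))
    (neq : forall z, h z <> h' z) :
  (forall w, continuous (fun z => h z w)) -> (forall w, continuous (fun z => h' z w)) ->
  continuous (fun z => conf_of (ph z) (ph' z) (@neq z)).
Proof.
have cbary (k : Z -> V -> R) v : (forall w, continuous (fun z => k z w)) ->
    continuous (fun z => bary (k z) v).
  by move=> ck; apply: continuous_sub => //; apply: continuous_sumr.
move=> ch ch'; apply: continuous_conf2; apply: continuous_realization => v.
  by under eq_fun do rewrite !set_valE /=; apply: cbary.
by under eq_fun do rewrite !set_valE /=; apply: cbary.
Qed.

Lemma profile1_continuous w : continuous (fun p : C => profile1 p w).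
Proof. by apply: continuous_sumr => v; apply: conf2_coord_continuous. Qed.

Lemma profile2_continuous w : continuous (fun p : C => profile2 p w).
Proof.
rewrite (_ : (fun p => _) = (fun p => profile1 p w) \o conf2_swap R e).
  move=> p; apply: (@continuous_comp C C R); first exact: conf2_swap_continuous.
  exact: profile1_continuous.
by apply/funext => p /=; rewrite profile1_swap.
Qed.

Section ContinuousProfiles.
Variables (Z : topologicalType) (hx hy : Z -> V -> R) (s : Z -> R).
Hypotheses (cx : forall w, continuous (fun z => hx z w)).
Hypotheses (cy : forall w, continuous (fun z => hy z w)).
Hypotheses (d0 : forall z, tree_dist (hx z) (hy z) != 0) (cs : continuous s).

Lemma height_continuous (h : Z -> V -> R) : (forall w, continuous (fun z => h z w)) ->
  continuous (fun z => height (h z)).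
Proof.
move=> ch; apply: continuous_sub; last exact: cst_continuous.
exact: continuous_sumr.
Qed.

Lemma meet_height_continuous : continuous (fun z => meet_height (hx z) (hy z)).
Proof. by apply: height_continuous => w; apply: continuous_minr. Qed.

Lemma tree_dist_continuous : continuous (fun z => tree_dist (hx z) (hy z)).
Proof.
rewrite /tree_dist /excess; under eq_fun do rewrite (meet_height_sym (hy _)).
by apply: continuous_add; apply: continuous_sub;
  [exact: height_continuous|exact: meet_height_continuous..|exact: height_continuous|
   exact: meet_height_continuous].
Qed.

Lemma ratio_continuous : continuous (fun z => ratio (hx z) (hy z)).
Proof.
apply: continuous_mul; last by apply: continuous_inv => //; apply: tree_dist_continuous.
by apply: continuous_sub; [apply: height_continuous|apply: meet_height_continuous].
Qed.

Lemma target_continuous (K t : Z -> R) : continuous K -> continuous t ->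
  continuous (fun z => target (K z) (t z)).
Proof.
move=> cK ct; have c2t : continuous (fun z => 2 * t z).
  by apply: continuous_mul => //; apply: cst_continuous.
apply: continuous_minr.
  by apply: continuous_mul => //; apply: continuous_add => //; apply: cst_continuous.
apply: continuous_add; first exact: cst_continuous.
by apply: continuous_mul => //; apply: continuous_sub => //; apply: cst_continuous.
Qed.

Lemma clamp_continuous (f : Z -> R) : continuous f -> continuous (fun z => clamp (f z)).
Proof.
move=> cf; apply: continuous_maxr; first exact: cst_continuous.
by apply: continuous_minr => //; apply: cst_continuous.
Qed.

Lemma moved_continuous w : continuous (fun z => moved (s z) (hx z) (hy z) w).
Proof.
apply: continuous_minr.
  apply: clamp_continuous; apply: continuous_add; last exact: cst_continuous.
  apply: continuous_sub; last exact: cst_continuous.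
  apply: continuous_add; apply: continuous_mul => //.
  - by apply: continuous_sub => //; apply: cst_continuous.
  - exact: height_continuous.
  - apply: target_continuous; [exact: meet_height_continuous|exact: ratio_continuous].
apply: continuous_mul => //; apply: continuous_add; first exact: cst_continuous.
apply: continuous_mul; first exact: cst_continuous.
by apply: continuous_inv => //; apply: tree_dist_continuous.
Qed.

End ContinuousProfiles.

Lemma prof_continuous (Z : topologicalType) (c : V) (r : Z -> R) w :
  continuous r -> continuous (fun z => prof c (r z) w).
Proof.
move=> cr; rewrite /prof; case: (anc w c); last exact: cst_continuous.
apply: clamp_continuous; apply: continuous_add; last exact: cst_continuous.
by apply: continuous_sub => //; apply: cst_continuous.
Qed.

Definition conf_ratio (p : C) : I :=
  unitI_of (position_ratio (profile1_position p) (profile2_position p) (@profile_neq p)).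

Lemma conf_ratioE p : set_val (conf_ratio p) = ratio (profile1 p) (profile2 p).
Proof. exact: unitI_ofE. Qed.

Lemma conf_dist_gt0 p : 0 < tree_dist (profile1 p) (profile2 p).
Proof.
apply: position_tree_dist_gt0; [exact: profile1_position|exact: profile2_position|].
exact: profile_neq.
Qed.

Lemma conf_ratio_swap p : conf_ratio (conf2_swap R e p) = unitI_rev (conf_ratio p).
Proof.
apply: unitI_inj; rewrite conf_ratioE profile1_swap profile2_swap.
rewrite ratio_rev; last by rewrite gt_eqF ?conf_dist_gt0.
by rewrite unitI_revE conf_ratioE.
Qed.

Lemma conf_ratio_continuous : continuous conf_ratio.
Proof.
apply: continuous_unitI.
have -> : (fun p => set_val (conf_ratio p)) = (fun p => ratio (profile1 p) (profile2 p)).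
  by apply/funext => p; apply: conf_ratioE.
apply: ratio_continuous; [exact: profile1_continuous|exact: profile2_continuous|].
by move=> p; rewrite gt_eqF ?conf_dist_gt0.
Qed.

Variable l0 : label e u0.

Definition conf_label (p : C) : label e u0 :=
  if pselect (exists l, in_cell l (profile1 p) (profile2 p)) is left ex
  then projT1 (cid ex) else l0.

Lemma conf_label_in p : 0 < (set_val (conf_ratio p) : R) < 1 ->
  in_cell (conf_label p) (profile1 p) (profile2 p).
Proof.
rewrite conf_ratioE /conf_label; case: pselect => [ex _|nex h]; first by case: cid.
case: nex; exact: in_cell_ex (profile1_position p) (profile2_position p) (@profile_neq p) h.
Qed.

Lemma conf_label_eq p l : in_cell l (profile1 p) (profile2 p) -> conf_label p = l.
Proof.
move=> cl; rewrite /conf_label; case: pselect => [ex|[]]; last by exists l.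
by case: cid => l' /= cl'; apply: (in_cell_inj (profile1_position p) (profile2_position p)) cl.
Qed.

Definition to_cell (p : C) : Q := cell_point (conf_label p) (conf_ratio p).

Lemma to_cell_continuous : continuous to_cell.
Proof.
apply: continuous_cell_point; first exact: conf_ratio_continuous.
move=> p /conf_label_in /andP[c1 c2]; have Fp : Filter (nbhs p) by exact: nbhs_filter.
have n1 := near_gt0 (@profile1_continuous _) c1.
have n2 := near_gt0 (@profile2_continuous _) c2.
apply: (@filterS _ _ Fp _ _ _ (@filterI _ _ Fp _ _ n1 n2)) => q [q1 q2].
by apply: conf_label_eq; rewrite /in_cell q1.
Qed.

Lemma to_cell_equivariant : equivariant (conf2_swap R e) (QGamma_T R e u0) to_cell.
Proof.
move=> p; rewrite /to_cell cell_point_T conf_ratio_swap.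
have [mid|ends] := boolP (0 < (set_val (conf_ratio p) : R) < 1); last first.
  apply: cell_point_end; apply: contra ends; rewrite unitI_revE; lra.
congr cell_point; apply: conf_label_eq; rewrite profile1_swap profile2_swap.
have [s1 s2] := label_child_swap (conf_label p).
by have /andP[c1 c2] := conf_label_in mid; rewrite /in_cell s1 s2 c1 c2.
Qed.

Definition cell_conf (l : label e u0) (t : I) : C :=
  conf_of (cell_position l (unitI_bound t))
    (cell_position (label_swap l) (unit_rev (unitI_bound t))) (cell_neq (unitI_bound t)).

Lemma profile1_cell l t : profile1 (cell_conf l t) = cell_profile l (set_val t).
Proof. exact: profile1_conf_of. Qed.

Lemma profile2_cell l t :
  profile2 (cell_conf l t) = cell_profile (label_swap l) (1 - set_val t).
Proof. exact: profile2_conf_of. Qed.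

Lemma cell_conf0 l l2 : cell_conf l unitI0 = cell_conf l2 unitI0.
Proof.
apply: profile_inj; rewrite ?profile1_cell ?profile2_cell unitI0E ?cell_profile0//.
by rewrite subr0; apply: cell_profile1.
Qed.

Lemma cell_conf1 l l2 : cell_conf l unitI1 = cell_conf l2 unitI1.
Proof.
apply: profile_inj; rewrite ?profile1_cell ?profile2_cell unitI1E.
  exact: cell_profile1.
by rewrite subrr !cell_profile0.
Qed.

Lemma cell_conf_swap l t :
  conf2_swap R e (cell_conf l t) = cell_conf (label_swap l) (unitI_rev t).
Proof.
apply: profile_inj; rewrite ?profile1_swap ?profile2_swap
  !(profile1_cell, profile2_cell) unitI_revE//.
by rewrite label_swapK subKr.
Qed.

Lemma cell_conf_continuous l : continuous (cell_conf l).
Proof.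
apply: continuous_conf_of => w; apply: prof_continuous; apply: target_continuous;
  try exact: cst_continuous; first exact: unitI_val_continuous.
by apply: continuous_sub; [exact: cst_continuous|exact: unitI_val_continuous].
Qed.

Lemma cell_conf_ratio l : conf_ratio (cell_conf l unitI0) = unitI0 /\
  conf_ratio (cell_conf l unitI1) = unitI1.
Proof.
split; apply: unitI_inj; rewrite conf_ratioE profile1_cell profile2_cell ?unitI0E ?unitI1E.
  by rewrite subr0 cell_ratio0.
by rewrite subrr cell_ratio1.
Qed.

Lemma cell_conf_label l t : 0 < (set_val (conf_ratio (cell_conf l t)) : R) < 1 ->
  conf_label (cell_conf l t) = l.
Proof.
by move=> /conf_label_in; rewrite profile1_cell profile2_cell => /in_cell_cell.
Qed.

Definition pre_conf (p : pre_Q R e u0) : C :=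
  match p with
  | existT (Some l) t => cell_conf l t
  | existT None b => cell_conf l0 (if b then unitI1 else unitI0)
  end.

Definition from_cell (q : Q) : C := pre_conf (repr q).

Lemma from_cell_pi p : from_cell (\pi_Q p)%qT = pre_conf p.
Proof.
have attE q : pre_conf (attach q) = pre_conf q.
  case: q => -[l t|b] //=; case: eqVneq => [->|_] /=; first exact: cell_conf0.
  by case: eqVneq => [->|_] //=; apply: cell_conf1.
rewrite /from_cell -attE -[RHS]attE; congr pre_conf.
by apply/pi_QGammaP; rewrite reprK.
Qed.

Lemma from_cell_point l t : from_cell (cell_point l t) = cell_conf l t.
Proof. exact: from_cell_pi. Qed.

Lemma from_cell_continuous : continuous from_cell.
Proof.
apply/(@quotient_continuous _ Q).
have -> : from_cell \o \pi_Q%qT = pre_conf by apply/funext => p; rewrite /= from_cell_pi.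
pose F (o : option (label e u0)) : precell R o -> C := fun y => pre_conf (existT _ o y).
have -> : pre_conf = (fun p => F _ (projT2 p)) by apply/funext => -[].
apply: (@sigT_continuous _ _ _ F) => -[l|]; first exact: cell_conf_continuous.
by apply/continuousP => U _; apply: discrete_open.
Qed.

Lemma from_cell_equivariant : equivariant (QGamma_T R e u0) (conf2_swap R e) from_cell.
Proof.
move=> q; rewrite (cell_pointE l0 q) cell_point_T !from_cell_point.
by rewrite cell_conf_swap.
Qed.

Lemma profile1_from_to p :
  profile1 (from_cell (to_cell p)) = moved 1 (profile1 p) (profile2 p).
Proof.
rewrite /to_cell from_cell_point profile1_cell conf_ratioE; apply/esym.
apply: (moved1 (profile1_position p) (profile2_position p) (@profile_neq p)).
by rewrite -conf_ratioE => /conf_label_in.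
Qed.

Lemma profile2_from_to p :
  profile2 (from_cell (to_cell p)) = moved 1 (profile2 p) (profile1 p).
Proof.
rewrite -profile1_swap -from_cell_equivariant -to_cell_equivariant profile1_from_to.
by rewrite profile1_swap profile2_swap.
Qed.

(** Time is reversed, so that the motion goes from the composite to the
    identity. *)
Definition conf_homotopy (z : C * I) : C :=
  let s01 := unit_rev (unitI_bound z.2) in
  let p1 := profile1_position z.1 in let p2 := profile2_position z.1 in
  let n := @profile_neq z.1 in
  conf_of (moved_position p1 p2 n s01) (moved_position p2 p1 (not_eq_sym n) s01)
    (moved_distinct p1 p2 n s01).

Lemma profile1_conf_homotopy p t : profile1 (conf_homotopy (p, t)) =
  moved (1 - set_val t) (profile1 p) (profile2 p).
Proof. exact: profile1_conf_of. Qed.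

Lemma profile2_conf_homotopy p t : profile2 (conf_homotopy (p, t)) =
  moved (1 - set_val t) (profile2 p) (profile1 p).
Proof. exact: profile2_conf_of. Qed.

Lemma conf_homotopy_continuous : continuous conf_homotopy.
Proof.
have c1 w : continuous (fun z : C * I => profile1 z.1 w).
  exact: (continuous_fst (@profile1_continuous w)).
have c2 w : continuous (fun z : C * I => profile2 z.1 w).
  exact: (continuous_fst (@profile2_continuous w)).
have cs : continuous (fun z : C * I => 1 - set_val z.2 : R).
  apply: continuous_sub; first exact: cst_continuous.
  exact: (continuous_snd (@unitI_val_continuous R)).
have d0 (z : C * I) := conf_dist_gt0 z.1.
apply: continuous_conf_of => w; apply: moved_continuous => // z; rewrite gt_eqF//.
by rewrite tree_dist_sym.
Qed.

Lemma conf_homotopic :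
  equivariantly_homotopic R (conf2_swap R e) (conf2_swap R e) (from_cell \o to_cell) id.
Proof.
exists conf_homotopy; split; first exact: conf_homotopy_continuous.
- move=> p; apply: profile_inj; rewrite ?profile1_conf_homotopy ?profile2_conf_homotopy.
    by rewrite unitI0E subr0 /= profile1_from_to.
  by rewrite unitI0E subr0 /= profile2_from_to.
- move=> p; apply: profile_inj; rewrite ?profile1_conf_homotopy ?profile2_conf_homotopy
    unitI1E subrr.
    exact: moved0 (profile1_position p) (profile2_position p) (@profile_neq p).
  exact: moved0 (profile2_position p) (profile1_position p) (not_eq_sym (@profile_neq p)).
- move=> t p; apply: profile_inj.
    by rewrite profile1_swap profile1_conf_homotopy profile2_conf_homotopy
      profile1_swap profile2_swap.
  by rewrite profile2_swap profile1_conf_homotopy profile2_conf_homotopy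
    profile1_swap profile2_swap.
Qed.

Lemma segment_subproof (s a b : I) :
  0 <= (1 - set_val s) * set_val a + set_val s * set_val b <= 1.
Proof.
have /andP[s0 s1] := unitI_bound s; have /andP[a0 a1] := unitI_bound a.
have /andP[b0 b1] := unitI_bound b; nra.
Qed.

Definition segment (s a b : I) : I := unitI_of (segment_subproof s a b).

Lemma segmentE s a b : set_val (segment s a b) =
  (1 - set_val s) * set_val a + set_val s * set_val b.
Proof. exact: unitI_ofE. Qed.

Lemma segment_refl s a : segment s a a = a.
Proof. by apply: unitI_inj; rewrite segmentE; lra. Qed.

Lemma segment_rev s a b : segment s (unitI_rev a) (unitI_rev b) = unitI_rev (segment s a b).
Proof.
by apply: unitI_inj; rewrite unitI_revE !segmentE !unitI_revE; lra.
Qed.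

(** The composite on the complex fixes the two 0-cells. *)
Lemma tau_end q : ~~ (0 < (set_val (tauQ q) : R) < 1) ->
  conf_ratio (from_cell q) = tauQ q.
Proof.
move=> ends; rewrite (cell_pointE l0 q) from_cell_point tauQ_cell_point.
have [r0 r1] := cell_conf_ratio (labelQ l0 q).
have /andP[t0 t1] := unitI_bound (tauQ q); move: ends; rewrite negb_and -!leNgt => /orP[h|h].
  by have -> : tauQ q = unitI0 by apply: unitI_inj; rewrite unitI0E; apply/eqP; rewrite eq_le h.
by have -> : tauQ q = unitI1 by apply: unitI_inj; rewrite unitI1E; apply/eqP; rewrite eq_le t1.
Qed.

Definition cell_homotopy (z : Q * I) : Q :=
  cell_point (labelQ l0 z.1) (segment z.2 (conf_ratio (from_cell z.1)) (tauQ z.1)).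

(** At a 0-cell the parameter stays constant, so the choice of the label is
    immaterial. *)
Lemma cell_homotopy_end q s : ~~ (0 < (set_val (tauQ q) : R) < 1) -> cell_homotopy (q, s) = q.
Proof.
by move=> ends; rewrite /cell_homotopy /= tau_end// segment_refl -cell_pointE.
Qed.

Lemma cell_homotopy_continuous : continuous cell_homotopy.
Proof.
apply: (@continuous_cell_point R V e u0 _ (fun z : Q * I => labelQ l0 z.1)
  (fun z => segment z.2 (conf_ratio (from_cell z.1)) (tauQ z.1))).
  apply: continuous_unitI.
  rewrite (_ : (fun z => _) = (fun z : Q * I =>
    (1 - set_val z.2) * set_val (conf_ratio (from_cell z.1)) +
    set_val z.2 * set_val (tauQ z.1))); last by apply/funext => z; apply: segmentE.
  have cs : continuous (fun z : Q * I => set_val z.2 : R).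
    exact: (continuous_snd (@unitI_val_continuous R)).
  apply: continuous_add; apply: continuous_mul => //.
  - by apply: continuous_sub => //; apply: cst_continuous.
  - apply: (@continuous_fst _ _ _ (fun q : Q => set_val (conf_ratio (from_cell q)) : R)) => q.
    apply: (@continuous_comp _ _ _ from_cell (fun p => set_val (conf_ratio p) : R)).
      exact: from_cell_continuous.
    apply: (@continuous_comp _ _ _ conf_ratio (fun t => set_val t : R)).
      exact: conf_ratio_continuous.
    exact: unitI_val_continuous.
  - apply: (@continuous_fst _ _ _ (fun q : Q => set_val (tauQ q) : R)) => q.
    apply: (@continuous_comp _ _ _ (@tauQ R V e u0) (fun t => set_val t : R)).
      exact: tauQ_continuous.
    exact: unitI_val_continuous.
move=> [q s] mid; have [midq|ends] := boolP (0 < (set_val (tauQ q) : R) < 1).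
  exact: (@cvg_fst _ _ (nbhs q) (nbhs s) (nbhs_filter s) _ (labelQ_near l0 midq)).
by move: mid; rewrite /= tau_end// segment_refl (negbTE ends).
Qed.

Lemma cell_homotopic :
  equivariantly_homotopic R (QGamma_T R e u0) (QGamma_T R e u0) (to_cell \o from_cell) id.
Proof.
exists cell_homotopy; split; first exact: cell_homotopy_continuous.
- move=> q; rewrite /cell_homotopy /=.
  have -> : segment unitI0 (conf_ratio (from_cell q)) (tauQ q) = conf_ratio (from_cell q).
    by apply: unitI_inj; rewrite segmentE unitI0E; lra.
  rewrite /to_cell.
  have [mid|ends] := boolP (0 < (set_val (conf_ratio (from_cell q)) : R) < 1).
    have cE : from_cell q = cell_conf (labelQ l0 q) (tauQ q).
      by rewrite {1}(cell_pointE l0 q) from_cell_point.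
    by rewrite cE in mid *; rewrite (cell_conf_label mid).
  exact: cell_point_end.
- move=> q; rewrite /cell_homotopy /=.
  have -> : segment unitI1 (conf_ratio (from_cell q)) (tauQ q) = tauQ q.
    by apply: unitI_inj; rewrite segmentE unitI1E; lra.
  by rewrite -cell_pointE.
- move=> s q.
  have tT : tauQ (QGamma_T R e u0 q) = unitI_rev (tauQ q).
    by rewrite {1}(cell_pointE l0 q) cell_point_T tauQ_cell_point.
  have [mid|ends] := boolP (0 < (set_val (tauQ q) : R) < 1); last first.
    rewrite !cell_homotopy_end//; apply: contra ends; rewrite tT unitI_revE; lra.
  rewrite /cell_homotopy /= cell_point_T tT from_cell_equivariant conf_ratio_swap segment_rev.
  congr cell_point; rewrite {1}(cell_pointE l0 q) cell_point_T labelQ_cell_point// unitI_revE.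
  by move: mid; lra.
Qed.

Lemma homotopy_equivalence :
  Z2_homotopy_equivalent R C Q (conf2_swap R e) (QGamma_T R e u0).
Proof.
exists to_cell, from_cell; split.
- by split; [exact: to_cell_continuous|exact: to_cell_equivariant].
- by split; [exact: from_cell_continuous|exact: from_cell_equivariant].
- exact: conf_homotopic.
- exact: cell_homotopic.
Qed.

End RootedTree.

Theorem theorem11p1 (R : realType) (V : finType) (e : rel V) (u0 : V)
    (tree_e : is_tree e) (ess_e : exists v : V, essential e v)
    (root_u0 : univalent e u0) :
  Z2_homotopy_equivalent R (set_type (conf2 R e)) (QGamma R e u0)
    (conf2_swap R e) (QGamma_T R e u0).
Proof.
have [c [c' cc']] := sibling_pair_exists tree_e root_u0 ess_e.
have [l _] := label_of_siblings tree_e root_u0 cc'.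
exact: (homotopy_equivalence tree_e root_u0 R l).
Qed.
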